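(* Let $T$ be a unit trapezoid whose shorter leg has length $h$, whose shorter base has length $a$ and whose longer base has length $b$. If $T$ is a reptile, then $a$ and $b$ both belong to $\mathbb{Q}_h=\{p+qh : p,q\in\mathbb{Q}\}$.
   Context: A planar figure is rep-$n$ if it can be dissected into $n$ similar copies of itself that are congruent to each other (reflected copies are allowed); it is a reptile if it is rep-$n$ for some $n\ge 2$. A unit trapezoid is a trapezoid that is not a parallelogram and whose longest leg has length $1$; its bases are the two parallel sides (of different lengths) and its legs are the other two sides. If the trapezoid is isosceles, both legs have length $1$, so $h=1$. *)

(* Defs.v *)
From mathcomp Require Import all_boot all_order all_algebra.
From mathcomp Require Import all_classical all_reals all_analysis.

Set Implicit Arguments.
Unset Strict Implicit.
Unset Printing Implicit Defensive.

Import Order.TTheory GRing.Theory Num.Theory.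
Import numFieldNormedType.Exports.

Local Open Scope classical_set_scope.
Local Open Scope ring_scope.

(* The library norm on ['rV[R]_2] is the sup norm, so Euclidean distance is
   defined explicitly; the two induce the same topology. *)
Definition dist (R : realType) (x y : 'rV[R]_2) : R :=
  Num.sqrt (\sum_(i < 2) (x 0 i - y 0 i) ^+ 2).

Definition similarity (R : realType) (k : R) (f : 'rV[R]_2 -> 'rV[R]_2) :=
  0 < k /\ forall x y, dist (f x) (f y) = k * dist x y.

(* Orientation-reversing maps are included, so reflected copies are allowed. *)
Definition similar (R : realType) (P Q : set 'rV[R]_2) :=
  exists k f, similarity k f /\ f @` P = Q.

Definition congruent (R : realType) (P Q : set 'rV[R]_2) :=
  exists f, similarity 1 f /\ f @` P = Q.

Definition dissection (R : realType) (n : nat) (T : set 'rV[R]_2)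
    (P : 'I_n -> set 'rV[R]_2) :=
  T = \bigcup_i P i /\
  forall i j, i != j -> (P i)° `&` (P j)° = set0.

Definition rep (R : realType) (n : nat) (T : set 'rV[R]_2) :=
  exists P : 'I_n -> set 'rV[R]_2,
    [/\ dissection T P,
        forall i, similar T (P i)
      & forall i j, congruent (P i) (P j)].

Definition reptile (R : realType) (T : set 'rV[R]_2) :=
  exists2 n, (2 <= n)%N & rep n T.

Definition cross (R : realType) (u v : 'rV[R]_2) : R :=
  u 0 0 * v 0 1 - u 0 1 * v 0 0.

Definition parallel (R : realType) (u v : 'rV[R]_2) := cross u v = 0.

Definition orient (R : realType) (A B C : 'rV[R]_2) : R :=
  cross (B - A) (C - A).

(* Four points, in cyclic order, are the vertices of a nondegenerate convex
   quadrilateral iff the polygon ABCD turns strictly the same way at each. *)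
Definition convex_quadrilateral (R : realType) (A B C D : 'rV[R]_2) :=
  [/\ 0 < orient A B C, 0 < orient B C D,
      0 < orient C D A & 0 < orient D A B] \/
  [/\ orient A B C < 0, orient B C D < 0,
      orient C D A < 0 & orient D A B < 0].

(* Bases AB and CD, legs BC and DA; parallelograms are excluded. *)
Definition trapezoid (R : realType) (A B C D : 'rV[R]_2) :=
  [/\ convex_quadrilateral A B C D,
      parallel (B - A) (D - C)
    & ~ parallel (C - B) (A - D)].

Definition unit_trapezoid (R : realType) (A B C D : 'rV[R]_2) :=
  trapezoid A B C D /\ Num.max (dist B C) (dist D A) = 1.

(* The closed region bounded by a convex quadrilateral: the convex hull of its
   vertices. *)
Definition region (R : realType) (A B C D : 'rV[R]_2) : set 'rV[R]_2 :=
  [set x | exists s t u v : R,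
     [/\ [/\ 0 <= s, 0 <= t, 0 <= u & 0 <= v],
         s + t + u + v = 1
       & x = s *: A + t *: B + u *: C + v *: D]].

Definition Qadjoin (R : realType) (h : R) : set R :=
  [set x | exists p q : rat, x = ratr p + ratr q * h].

(* Main.v *)
Require Import Defs.
From mathcomp Require Import all_boot all_order all_algebra.
From mathcomp Require Import all_classical all_reals all_analysis.
From mathcomp Require Import ring lra.

Import Order.TTheory GRing.Theory Num.Theory.
Import numFieldNormedType.Exports.

(** The proof replaces lengths by weights.  Let [n >= 2], and suppose that the
    trapezoid is tiled by copies of ratio [1 / n].  Let [F] be a function on the
    real line that has both legs of a tile as periods and that increases by [wa]
    and [wb] along its short and long bases ([side_weights]).  If a base were not
    in the rational span of the legs, some [F] with [(wa, wb) <> (0, 0)] would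
    exist ([rational_functional]); it is additive on the lengths that occur and
    wild elsewhere.  The heart of the proof is that all weights vanish
    ([weights_zero]).

    The main tool is a balance of weights.  On a line in any direction that
    crosses the figure, the sides of the tiles lying on either side of the line
    have the same total weight, and on a line through a side of the figure they
    add up to the weight of that side ([balance], [base_sum], [roof_sum]).  The
    reason is [partition_telescope]: the endpoints of intervals that partition an
    interval cancel, whatever [F] is ([up_sum]).  Up to the sign of [F] there are
    three cases.

    If [wa] and [wb] are positive ([positive_weights_absurd]), the bases of all
    tiles are parallel to those of the figure: in another direction the boundary
    of the figure has weight zero, and the lowest tile with bases in this
    direction would have nothing to rest on.  Hence the tiles form layers.  The
    two sides of a layer differ in length by the amount that forces one more
    upright tile than inverted ones in each layer.  Two consecutive layers cannot
    both satisfy this and agree on their common line.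

    If [wa < 0 <= wb] ([negative_roof_absurd]), the short base of the figure
    consists of [n] short bases of tiles, and below it these tiles widen [n] times
    as fast as the figure.

    If [wa = 0 < wb] ([zero_roof_absurd]), the long base of the figure consists of
    [n] long bases of tiles.  So no tile stands on it with its short base, and by
    the balance of weights no tile stands with its long base on the line one level
    above.  But the long leg of the figure has weight zero, so it meets no long
    base.  Comparing slices parallel to this leg, first by their lengths and then
    by the differences of the squares of their endpoints, shows that the tiles
    along it are stacked in the orientation of the figure ([leg_column]), and the
    second one stands on that line.

    Any dissection into similar copies leads to such an integral ratio.  All
    copies have the same ratio [k] ([ratio_le]).  Iterating the tiling and
    comparing areas of squares inside and around the tiles gives [N * k ^+ 2 = 1]
    for the number [N] of tiles ([tile_count]), and composing the tiling with
    itself yields tiles of ratio [1 / N] ([tiling_iter]). *)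

Set Implicit Arguments.
Unset Strict Implicit.
Unset Printing Implicit Defensive.

Local Open Scope classical_set_scope.
Local Open Scope ring_scope.

(** * Telescoping sums over partitions of an interval *)

Section StepFunctions.
Variable R : realType.
Implicit Types (s : seq R) (v t : R).

Lemma just_below s v : exists2 t, t < v & forall x, x \in s -> x < v -> x < t.
Proof.
elim: s => [|x s [t tv ts]]; first by exists (v - 1) => //; lra.
have [xv|vx] := ltP x v.
  exists (Num.max t ((x + v) / 2)); first by rewrite gt_max tv /=; lra.
  move=> y; rewrite inE lt_max => /orP[/eqP -> _|/ts yt yv].
    by apply/orP; right; lra.
  by rewrite yt.
exists t => // y; rewrite inE => /orP[/eqP ->|]; last exact: ts.
by move=> xv; lra.
Qed.

Lemma just_above s v : exists2 t, v < t & forall x, x \in s -> v < x -> t < x.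
Proof.
have [t tv ts] := just_below [seq - x | x <- s] (- v).
exists (- t); first by lra.
move=> x xs vx; suff : - x < t by lra.
by apply: ts; [exact: map_f|lra].
Qed.

(** The jump at [v] of the step function that sums the [sg k] over [x k < t] is
    the sum of the [sg k] over [x k = v].  So these sums vanish point by point,
    and the sum against [F] is a combination of them. *)
Lemma jump_sum (K : finType) (sg x : K -> R) s :
    (forall t, t \notin s -> \sum_k sg k * (x k < t)%R%:R = 0) ->
  forall F : R -> R, \sum_k sg k * F (x k) = 0.
Proof.
move=> step0 F.
have jump0 v : \sum_(k | x k == v) sg k = 0.
  pose r := s ++ [seq x k | k <- enum K].
  have [t tv tr] := just_below r v; have [u vu ur] := just_above r v.
  have xr k : x k \in r by rewrite mem_cat map_f ?orbT // mem_enum.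
  have ts : t \notin s.
    apply/negP => ts; suff : t < t by rewrite ltxx.
    by apply: tr => //; rewrite mem_cat ts.
  have us : u \notin s.
    apply/negP => us; suff : u < u by rewrite ltxx.
    by apply: ur => //; rewrite mem_cat us.
  transitivity (\sum_k sg k * (x k < u)%R%:R - \sum_k sg k * (x k < t)%R%:R).
    rewrite -sumrB [LHS]big_mkcond; apply: eq_bigr => k _.
    have [xv|xv|->] := ltgtP (x k) v.
    - by rewrite (tr _ (xr k) xv) (lt_trans xv vu) subrr.
    - by rewrite (lt_gtF (ur _ (xr k) xv)) (lt_gtF (lt_trans tv xv)) subrr.
    - by rewrite vu (lt_gtF tv) mulr0 subr0 mulr1.
  by rewrite !step0 // subrr.
pose vs := undup [seq x k | k <- enum K].
have FE k : F (x k) = \sum_(v <- vs | x k == v) F v.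
  have xk : x k \in vs by rewrite mem_undup map_f // mem_enum.
  rewrite (big_rem (x k)) //= eqxx big1_seq ?addr0 // => v.
  by rewrite mem_rem_uniq ?undup_uniq // inE => /andP[/eqP->]; rewrite eqxx.
under eq_bigr do rewrite FE mulr_sumr.
rewrite (exchange_big_dep predT) //= big1_seq // => v _.
by rewrite -mulr_suml jump0 mul0r.
Qed.

(** Every inner point is left and entered equally often.  Below, [F] is a wild
    function that reads off a rational coordinate of lengths, the identity, the
    square, or the indicator of a point. *)
Lemma partition_telescope (I : finType) (act : pred I) (l r : I -> R) L U s :
    (forall i, act i -> l i <= r i) -> L <= U ->
    (forall t, t \notin s -> L < t < U -> exists2 i, act i & l i < t < r i) ->
    (forall t i, t \notin s -> act i -> l i < t < r i -> L < t < U) ->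
    (forall t i j, t \notin s -> act i -> act j ->
       l i < t < r i -> l j < t < r j -> i = j) ->
  forall F : R -> R, \sum_(i | act i) (F (r i) - F (l i)) = F U - F L.
Proof.
move=> lr LU cov sub disj F.
pose K := ((option I) * bool)%type.
pose sg (k : K) : R := (if k.2 then 1 else -1) *
  (if k.1 is Some i then (act i)%:R else -1).
pose x (k : K) : R :=
  if k.1 is Some i then (if k.2 then l i else r i) else (if k.2 then L else U).
have sumK (G : R -> R) : \sum_k sg k * G (x k) =
    \sum_(i | act i) (G (l i) - G (r i)) - (G L - G U).
  rewrite -(pair_bigA _ (fun o b => sg (o, b) * G (x (o, b)))) /=.
  under eq_bigr do rewrite big_bool /=.
  rewrite (bigD1 None) //= addrC; congr (_ + _); last first.
    by rewrite /sg /x /=; ring.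
  rewrite (reindex_omap Some id) //=; last by case.
  rewrite [RHS]big_mkcond /=; apply: eq_big => [i|i _]; first by rewrite eqxx.
  by rewrite /sg /x /=; case: (act i) => /=; ring.
have := @jump_sum K sg x (s ++ [seq x k | k <- enum {: K}]) _ F.
rewrite sumK => H.
suff : \sum_(i | act i) (F (l i) - F (r i)) - (F L - F U) = 0.
  rewrite (eq_bigr (fun i => - (F (r i) - F (l i)))); last by move=> *; ring.
  by rewrite sumrN; lra.
apply: H => t; rewrite mem_cat negb_or => /andP[ts tx].
rewrite (sumK (fun y => (y < t)%R%:R)) /=.
have xt k : x k != t by apply: contraNneq tx => <-; rewrite map_f // mem_enum.
have ind y z : y <= z -> y != t -> z != t ->
    (y < t)%R%:R - (z < t)%R%:R = ((y < t < z)%R%:R : R).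
  move=> yz yt zt; have [zt'|tz|/eqP] := ltgtP z t; last by rewrite (negbTE zt).
    by rewrite (le_lt_trans yz zt') /= subrr.
  by rewrite andbT subr0.
rewrite (ind L U) //; [|exact: (xt (None, true))|exact: (xt (None, false))].
rewrite (eq_bigr (fun i => (l i < t < r i)%R%:R)); last first.
  move=> i ai; apply: ind; first exact: lr.
    exact: (xt (Some i, true)).
  exact: (xt (Some i, false)).
have [LtU|nLtU] := boolP (L < t < U).
  have [i ai lti] := cov t ts LtU.
  rewrite (bigD1 i) //= lti big1 ?addr0 ?subrr // => j /andP[aj ji].
  case: (boolP (l j < t < r j)) => // ltj.
  by rewrite (disj t j i) ?eqxx // in ji.
rewrite big1 ?subrr // => i ai.
by case: (boolP (l i < t < r i)) => // lti; rewrite (sub t i ts ai lti) in nLtU.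
Qed.

End StepFunctions.

(** * Similarities of the plane *)

Section Similarities.
Variable R : realType.

(** A similarity of ratio [sk] with value [(sx, sy)] at the origin, whose linear
    part sends the first unit vector to a multiple of [(sc, ss)] and the second
    one to the same multiple of [(- se * ss, se * sc)]: the sign [se] tells
    whether the orientation is preserved. *)
Record sim := Sim {
  sk : R; sc : R; ss : R; se : R; sx : R; sy : R;
  sk_gt0 : 0 < sk;
  sc_ss : sc ^+ 2 + ss ^+ 2 = 1;
  se_sq : se ^+ 2 = 1 }.

Implicit Types (f g : sim) (p : R * R).

Definition app g p : R * R :=
  (sx g + sk g * (sc g * p.1 - se g * ss g * p.2),
   sy g + sk g * (ss g * p.1 + se g * sc g * p.2)).

Definition un g p : R * R :=
  ((sc g * (p.1 - sx g) + ss g * (p.2 - sy g)) / sk g,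
   se g * (sc g * (p.2 - sy g) - ss g * (p.1 - sx g)) / sk g).

Lemma sk_neq0 g : sk g != 0. Proof. exact: lt0r_neq0 (sk_gt0 g). Qed.

Lemma appK g : cancel (app g) (un g).
Proof.
case: g => k c s e x y k0 cs ee [t u]; rewrite /app /un /=.
have kn : k != 0 by exact: lt0r_neq0.
congr (_, _).
  transitivity ((c ^+ 2 + s ^+ 2) * t); last by rewrite cs mul1r.
  by field.
transitivity ((c ^+ 2 + s ^+ 2) * e ^+ 2 * u); last by rewrite cs ee !mul1r.
by field.
Qed.

Lemma unK g : cancel (un g) (app g).
Proof.
case: g => k c s e x y k0 cs ee [t u]; rewrite /app /un /=.
have kn : k != 0 by exact: lt0r_neq0.
congr (_, _).
  transitivity (x + c ^+ 2 * (t - x) + e ^+ 2 * s ^+ 2 * (t - x)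
    + (1 - e ^+ 2) * c * s * (u - y)).
    by field.
  by rewrite ee subrr !mul0r addr0 mul1r -addrA -mulrDl cs; ring.
transitivity (y + e ^+ 2 * c ^+ 2 * (u - y) + s ^+ 2 * (u - y)
    + (1 - e ^+ 2) * c * s * (t - x)).
  by field.
by rewrite ee subrr !mul0r addr0 mul1r -addrA -mulrDl cs; ring.
Qed.

Lemma comp_k_gt0 f g : 0 < sk f * sk g.
Proof. by rewrite mulr_gt0 ?sk_gt0. Qed.

Lemma comp_cs f g : (sc f * sc g - se f * ss f * ss g) ^+ 2
  + (ss f * sc g + se f * sc f * ss g) ^+ 2 = 1.
Proof.
have cf := sc_ss f; have cg := sc_ss g; have ef := se_sq f.
transitivity ((sc f ^+ 2 + ss f ^+ 2) *
  (sc g ^+ 2 + se f ^+ 2 * ss g ^+ 2)); first by ring.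
by rewrite ef mul1r cf cg mulr1.
Qed.

Lemma comp_e f g : (se f * se g) ^+ 2 = 1.
Proof. by rewrite exprMn !se_sq mulr1. Qed.

Definition comp f g : sim :=
  Sim (app f (sx g, sy g)).1 (app f (sx g, sy g)).2
    (comp_k_gt0 f g) (comp_cs f g) (comp_e f g).

Lemma se_cases g : se g = 1 \/ se g = -1.
Proof.
have /eqP := se_sq g; rewrite sqrf_eq1 => /orP[] /eqP; by [left|right].
Qed.

Lemma app_comp f g p : app (comp f g) p = app f (app g p).
Proof.
rewrite /app /=; case: (se_cases f) => ->; congr (_, _); ring.
Qed.

Lemma un_comp f g p : un (comp f g) p = un g (un f p).
Proof. by rewrite -[p in LHS](unK f) -[un f p in LHS](unK g) -app_comp appK. Qed.

Definition rot (c s : R) (cs : c ^+ 2 + s ^+ 2 = 1) : sim :=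
  Sim 0 0 ltr01 cs (expr1n R 2).

End Similarities.

(** * Slices of convex polygons *)

Section Polygons.
Variable R : realType.
Implicit Types (q : R * R * R) (H : seq (R * R * R)) (p : R * R) (t Y : R).

(** A triple stands for the half-plane on which its affine form is nonnegative,
    and a list of triples for the intersection of their half-planes. *)
Definition aff q p : R := q.1.1 * p.1 + q.1.2 * p.2 + q.2.

Definition closed_in H p := all (fun q => 0 <= aff q p) H.
Definition open_in H p := all (fun q => 0 < aff q p) H.
Definition proper H := forall q, q \in H -> (q.1.1 != 0) || (q.1.2 != 0).

Lemma open_in_closed H p : open_in H p -> closed_in H p.
Proof. by apply: sub_all => q /ltW. Qed.

Lemma near0_affine (u v : R) : 0 < u -> \forall z \near 0^'+, 0 < u + v * z.
Proof.
move=> u0; near=> z.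
have z0 : 0 < z by near: z; exact: nbhs_right_gt.
have zu : z < u / (`|v| + 1).
  by near: z; apply: nbhs_right_lt; rewrite divr_gt0 // ltr_wpDl.
have : z * (`|v| + 1) < u by rewrite -ltr_pdivlMr // ltr_wpDl.
have := ler_norm (- v); rewrite normrN => nv.
have : - v * z <= `|v| * z by rewrite ler_wpM2r // ltW.
lra.
Unshelve. all: by end_near. Qed.

Lemma near0_all H (f : R * R * R -> R -> Prop) :
    (forall q, q \in H -> \forall z \near 0^'+, f q z) ->
  \forall z \near (0 : R)^'+, forall q, q \in H -> f q z.
Proof.
elim: H => [_|q H IH Hf]; first by near=> z.
have Hq := Hf q (mem_head _ _).
have HH : \forall z \near (0 : R)^'+, forall q, q \in H -> f q z.
  by apply: IH => r rH; apply: Hf; rewrite inE rH orbT.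
near=> z => r; rewrite inE => /orP[/eqP->|rH]; first by near: z.
by move: r rH; near: z.
Unshelve. all: by end_near. Qed.

Lemma closed_in_open_near H t Y : ~~ closed_in H (t, Y) ->
  \forall z \near 0^'+, ~~ closed_in H (t, Y + z).
Proof.
move=> /allPn[q qH]; rewrite -ltNge => qtY.
have := @near0_affine (- aff q (t, Y)) (- q.1.2); rewrite oppr_gt0 => /(_ qtY).
apply: filterS => z /= Hz; apply/allPn; exists q => //.
by rewrite -ltNge; move: Hz; rewrite /aff /=; lra.
Qed.

(** An affine form that is nonnegative on the slice and vanishes at an inner
    point vanishes on the whole slice.  As it is nonnegative at a point above the
    slice, it increases upwards. *)
Lemma open_in_near H l r t Y p : proper H ->
    closed_in H (l, Y) -> closed_in H (r, Y) -> closed_in H p -> Y < p.2 ->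
    l < t < r ->
  \forall z \near 0^'+, open_in H (t, Y + z).
Proof.
move=> pH /allP Hl /allP Hr /allP Hp Yp /andP[lt tr].
have : \forall z \near (0 : R)^'+, forall q, q \in H -> 0 < aff q (t, Y + z).
  apply: near0_all => q qH.
  have ql := Hl q qH; have qr := Hr q qH; have qp := Hp q qH.
  have E z : aff q (t, Y + z) = aff q (t, Y) + q.1.2 * z.
    by rewrite /aff /=; ring.
  have tl : 0 < t - l by lra.
  have rt : 0 < r - t by lra.
  have comb : (r - l) * aff q (t, Y) =
    (r - t) * aff q (l, Y) + (t - l) * aff q (r, Y) by rewrite /aff /=; ring.
  have cl : 0 <= (r - t) * aff q (l, Y) by rewrite mulr_ge0 // ltW.
  have cr : 0 <= (t - l) * aff q (r, Y) by rewrite mulr_ge0 // ltW.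
  have q0 : 0 <= aff q (t, Y).
    by rewrite -(@pmulr_rge0 _ (r - l)) ?comb ?addr_ge0 //; lra.
  move: q0; rewrite le0r => /predU1P[q0|q0]; last first.
    by apply: filterS (near0_affine q.1.2 q0) => z; rewrite E.
  have [l0 r0] : aff q (l, Y) = 0 /\ aff q (r, Y) = 0.
    move: comb; rewrite q0 mulr0 => /esym/eqP; rewrite paddr_eq0 //.
    by rewrite !mulf_eq0 (gt_eqF tl) (gt_eqF rt) => /andP[/eqP-> /eqP->].
  have a0 : q.1.1 = 0.
    apply/eqP; have : q.1.1 * (r - l) = 0.
      transitivity (aff q (r, Y) - aff q (l, Y)); first by rewrite /aff /=; ring.
      by rewrite l0 r0 subrr.
    by move/eqP; rewrite mulf_eq0 => /orP[//|/eqP]; lra.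
  have b0 : 0 < q.1.2.
    rewrite lt_def; have := pH q qH; rewrite a0 eqxx /= => ->.
    rewrite -(@pmulr_lge0 _ (p.2 - Y)) ?subr_gt0 //.
    by move: qp q0; rewrite /aff /= a0; lra.
  by apply: filterS (nbhs_right_gt 0) => z z0; rewrite E q0 add0r mulr_gt0.
by apply: filterS => z Hz; apply/allP.
Qed.

Lemma chord_ex H Y K : (forall t, closed_in H (t, Y) -> `|t| <= K) ->
  exists l r, forall t, closed_in H (t, Y) = (l <= t <= r).
Proof.
move=> bd; suff [l [r lr]] : exists l r, forall t,
    (- K <= t <= K) && closed_in H (t, Y) = (l <= t <= r).
  exists l, r => t; rewrite -lr; case: (boolP (closed_in _ _)) => [/bd|].
    by rewrite ler_norml => ->.
  by rewrite andbF.
elim: H {bd} => [|q H [l [r IH]]]; first by exists (- K), K => t; rewrite andbT.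
have [a0|a0|a0] := ltgtP q.1.1 0.
- exists l, (Num.min r ((q.1.2 * Y + q.2) / - q.1.1)) => t /=.
  rewrite andbCA IH le_min ler_pdivlMr ?oppr_gt0 // /aff /=.
  rewrite andbC -andbA; congr [&& _, _ & _]; apply/idP/idP; lra.
- exists (Num.max l (- (q.1.2 * Y + q.2) / q.1.1)), r => t /=.
  rewrite andbCA IH ge_max ler_pdivrMr // /aff /=.
  rewrite andbA [X in X && _]andbC; congr [&& _ && _ & _]; apply/idP/idP; lra.
have [c0|c0] := leP 0 (q.1.2 * Y + q.2).
  exists l, r => t /=; rewrite andbCA IH /aff /= a0 mul0r add0r c0 //.
exists 1, 0 => t /=; rewrite /aff /= a0 mul0r add0r (leNgt 0 (_ + _)) c0 /= andbF.
by apply/esym/negP => /andP[]; lra.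
Qed.

(** The endpoints of the horizontal slice at height [Y]. *)
Definition lo H Y : R := inf [set t | closed_in H (t, Y)].
Definition hi H Y : R := sup [set t | closed_in H (t, Y)].

Lemma lo_hi H Y l r : (forall t, closed_in H (t, Y) = (l <= t <= r)) ->
  l <= r -> lo H Y = l /\ hi H Y = r.
Proof.
move=> E lr; have -> : lo H Y = inf `[l, r]%classic.
  by congr inf; apply/seteqP; split => t /=; rewrite E in_itv.
have -> : hi H Y = sup `[l, r]%classic.
  by congr sup; apply/seteqP; split => t /=; rewrite E in_itv.
by rewrite inf_itv ?sup_itv // bnd_simp.
Qed.

Definition meets H Y := exists t, closed_in H (t, Y).
(** Polygons that are seen on a horizontal line when it is approached from
    above, respectively from below. *)
Definition upact H Y := `[< meets H Y /\ exists2 p, closed_in H p & Y < p.2 >].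
Definition dnact H Y := `[< meets H Y /\ exists2 p, closed_in H p & p.2 < Y >].
Definition bounded_in H := exists K, forall p, closed_in H p -> `|p.1| <= K.

Lemma chordP H Y : bounded_in H -> meets H Y ->
  lo H Y <= hi H Y /\
  forall t, closed_in H (t, Y) = (lo H Y <= t <= hi H Y).
Proof.
move=> [K bd] [t0 mt]; have [t|l [r E]] := @chord_ex H Y K; first exact: bd.
have lr : l <= r by move: mt; rewrite E => /andP[/le_trans]; apply.
by have [-> ->] := lo_hi E lr.
Qed.

End Polygons.

(** * Slices of tilings *)

Section Dissections.
Variables (R : realType) (I : finType).
Implicit Types (H C : seq (R * R * R)) (D : I -> seq (R * R * R)) (Y t : R).

Definition regular H := proper H /\ bounded_in H.

Definition dissects C D :=
  (forall p, closed_in C p <-> exists i, closed_in (D i) p) /\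
  (forall i j p, open_in (D i) p -> open_in (D j) p -> i = j).

Lemma upact_meets H Y : upact H Y -> meets H Y.
Proof. by move=> /asboolP[]. Qed.

Lemma upact_open_near H Y t : regular H -> upact H Y ->
  lo H Y < t < hi H Y -> \forall z \near 0^'+, open_in H (t, Y + z).
Proof.
move=> [pH bH] /asboolP[mH [p pin Yp]]; have [lh E] := chordP bH mH.
by apply: open_in_near pin Yp => //; rewrite E lexx ?lh.
Qed.

Lemma upact_out_near H Y t : regular H -> t != lo H Y -> t != hi H Y ->
    ~~ (upact H Y && (lo H Y < t < hi H Y)) ->
  \forall z \near 0^'+, ~~ closed_in H (t, Y + z).
Proof.
move=> [pH bH] tl th nact; have [tin|] := boolP (closed_in H (t, Y)); last first.
  exact: closed_in_open_near.
have mH : meets H Y by exists t.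
have [lh E] := chordP bH mH.
have lth : lo H Y < t < hi H Y.
  by rewrite !lt_neqAle th (eq_sym _ t) tl -E.
apply: filterS (nbhs_right_gt 0) => z z0; apply: contra nact => zin.
rewrite lth andbT; apply/asboolP; split => //.
by exists (t, Y + z) => //=; lra.
Qed.

(** Just above height [Y], the tiles that reach beyond [Y] cut the figure along
    the intervals that their own slices at height [Y] delimit. *)
Lemma up_sum C D Y : regular C -> (forall i, regular (D i)) -> dissects C D ->
    upact C Y ->
  forall F : R -> R, \sum_(i | upact (D i) Y) (F (hi (D i) Y) - F (lo (D i) Y))
    = F (hi C Y) - F (lo C Y).
Proof.
move=> rC rD [cov disj] aC.
pose s := lo C Y :: hi C Y ::
  [seq lo (D i) Y | i <- enum I] ++ [seq hi (D i) Y | i <- enum I].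
have sC t : t \notin s -> t != lo C Y /\ t != hi C Y.
  by rewrite !inE !negb_or => /and3P[].
have sD t i : t \notin s -> t != lo (D i) Y /\ t != hi (D i) Y.
  move=> ts; split; apply: contraNneq ts => ->; rewrite !inE mem_cat.
    by apply/or4P/Or43/mapP; exists i; rewrite ?mem_enum.
  by apply/or4P/Or44/mapP; exists i; rewrite ?mem_enum.
apply: (@partition_telescope _ _ _ (fun i => lo (D i) Y) (fun i => hi (D i) Y)
  (lo C Y) (hi C Y) s).
- by move=> i /upact_meets mi; case: (chordP (rD i).2 mi).
- by case: (chordP rC.2 (upact_meets aC)).
- move=> t ts ltU; have := upact_open_near rC aC ltU; apply: contraPP => nex.
  have allout : \forall z \near (0 : R)^'+,
      forall i, ~~ closed_in (D i) (t, Y + z).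
    apply: filter_forall => i; have [tl th] := sD t i ts.
    apply: upact_out_near => //; apply/negP => /andP[ai lti].
    by apply: nex; exists i.
  move=> Cnear; have [z [/open_in_closed zC zD]] := filter_ex (filterI Cnear allout).
  by have /cov[i] := zC; rewrite (negbTE (zD i)).
- move=> t i ts ai lti; have [tl th] := sC t ts; apply/negPn/negP => nC.
  have := upact_out_near rC tl th; rewrite (negbTE nC) andbF => /(_ isT) Cout.
  have Din := upact_open_near (rD i) ai lti.
  have [z [zC /open_in_closed zD]] := filter_ex (filterI Cout Din).
  by case/negP: zC; apply/cov; exists i.
- move=> t i j ts ai aj lti ltj.
  have Di := upact_open_near (rD i) ai lti.
  have Dj := upact_open_near (rD j) aj ltj.
  by have [z [zi zj]] := filter_ex (filterI Di Dj); exact: disj zi zj.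
Qed.

End Dissections.

Section Placements.
Variable R : realType.
Implicit Types (H : seq (R * R * R)) (g r : sim R) (p : R * R) (t Y : R).

Definition pull g (q : R * R * R) : R * R * R :=
  let u := (q.1.1 * sc g - q.1.2 * se g * ss g) / sk g in
  let v := (q.1.1 * ss g + q.1.2 * se g * sc g) / sk g in
  (u, v, q.2 - u * sx g - v * sy g).

Definition placed H g := map (pull g) H.

Lemma aff_pull g q p : aff (pull g q) p = aff q (un g p).
Proof. by rewrite /aff /un /pull /=; field; exact: sk_neq0. Qed.

Lemma closed_placed H g p : closed_in (placed H g) p = closed_in H (un g p).
Proof. by rewrite /closed_in all_map; apply: eq_all => q /=; rewrite aff_pull. Qed.

Lemma open_placed H g p : open_in (placed H g) p = open_in H (un g p).
Proof. by rewrite /open_in all_map; apply: eq_all => q /=; rewrite aff_pull. Qed.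

Definition bounded_poly H :=
  exists K, forall p, closed_in H p -> `|p.1| <= K /\ `|p.2| <= K.

Lemma placed_regular H g : proper H -> bounded_poly H -> regular (placed H g).
Proof.
move=> pH [K bH]; split.
  move=> _ /mapP[q /pH qH ->] /=; move: qH; rewrite -!negb_and.
  apply: contra; rewrite !mulf_eq0 !invr_eq0 (negbTE (sk_neq0 g)) !orbF.
  move=> /andP[/eqP u0 /eqP v0]; apply/andP; split; apply/eqP.
    transitivity (sc g * (q.1.1 * sc g - q.1.2 * se g * ss g)
      + ss g * (q.1.1 * ss g + q.1.2 * se g * sc g)); last by rewrite u0 v0; ring.
    transitivity (q.1.1 * (sc g ^+ 2 + ss g ^+ 2)); last by ring.
    by rewrite sc_ss mulr1.
  transitivity (- se g * ss g * (q.1.1 * sc g - q.1.2 * se g * ss g)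
    + se g * sc g * (q.1.1 * ss g + q.1.2 * se g * sc g)); last by rewrite u0 v0; ring.
  transitivity (q.1.2 * (se g ^+ 2 * (sc g ^+ 2 + ss g ^+ 2))); last by ring.
  by rewrite sc_ss se_sq !mulr1.
exists (`|sx g| + sk g * (`|sc g| * K + `|se g * ss g| * K)) => p.
rewrite closed_placed -{2}(unK g p) => /bH[b1 b2] /=.
rewrite (le_trans (ler_normD _ _)) // lerD2l normrM (gtr0_norm (sk_gt0 g)).
rewrite ler_pM2l ?sk_gt0 // (le_trans (ler_normB _ _)) // !(normrM _ (_ / _)).
by rewrite lerD // ler_wpM2l.
Qed.

(** Composition with a half-turn, which exchanges top and bottom. *)
Definition turn g := Sim (- sx g) (- sy g) (sk_gt0 g)
  (etrans (congr2 +%R (sqrrN (sc g)) (sqrrN (ss g))) (sc_ss g)) (se_sq g).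

Lemma un_turn g p : un (turn g) p = un g (- p.1, - p.2).
Proof.
by rewrite /un /=; congr (_, _); congr (_ / _); ring.
Qed.

Lemma closed_turn H g t Y :
  closed_in (placed H (turn g)) (t, Y) = closed_in (placed H g) (- t, - Y).
Proof. by rewrite !closed_placed un_turn. Qed.

Lemma meets_turn H g Y :
  meets (placed H (turn g)) Y <-> meets (placed H g) (- Y).
Proof.
split=> -[t]; first by rewrite closed_turn; exists (- t).
by move=> mt; exists (- t); rewrite closed_turn opprK.
Qed.

Lemma upact_turn H g Y : upact (placed H (turn g)) Y = dnact (placed H g) (- Y).
Proof.
apply/asboolP/asboolP => -[/meets_turn mY [[t Z] pin /= YZ]]; split => //.
  by exists (- t, - Z); rewrite -?closed_turn //= ltrN2.
by exists (- t, - Z); rewrite ?closed_turn ?opprK //= ltrNr.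
Qed.

Lemma dnact_turn H g Y : dnact (placed H (turn g)) Y = upact (placed H g) (- Y).
Proof.
apply/asboolP/asboolP => -[/meets_turn mY [[t Z] pin /= YZ]]; split => //.
  by exists (- t, - Z); rewrite -?closed_turn //= ltrN2.
by exists (- t, - Z); rewrite ?closed_turn ?opprK //= ltrNl.
Qed.

Lemma lo_hi_turn H g Y : bounded_in (placed H g) -> meets (placed H g) Y ->
  lo (placed H (turn g)) (- Y) = - hi (placed H g) Y /\
  hi (placed H (turn g)) (- Y) = - lo (placed H g) Y.
Proof.
move=> bH mH; have [lh E] := chordP bH mH.
apply: lo_hi => [t|]; last by rewrite lerN2.
by rewrite closed_turn opprK E lerNr [in RHS]andbC; congr (_ && _); rewrite lerNl.
Qed.

End Placements.

(** * Balance on a line, and the normal form of a trapezoid *)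

Section Balance.
Variables (R : realType) (I : finType) (H : seq (R * R * R)).
Hypotheses (pH : proper H) (bH : bounded_poly H).
Implicit Types (G : sim R) (g : I -> sim R) (Y : R) (F : R -> R).

Definition tiling G g := dissects (placed H G) (fun i => placed H (g i)).

Definition bottom K Y := upact (K : seq (R * R * R)) Y && ~~ dnact K Y.
Definition topmost K Y := dnact (K : seq (R * R * R)) Y && ~~ upact K Y.

Lemma closed_in_comp f k p :
  closed_in (placed H (comp f k)) p = closed_in (placed H k) (un f p).
Proof. by rewrite !closed_placed un_comp. Qed.

Lemma open_in_comp f k p :
  open_in (placed H (comp f k)) p = open_in (placed H k) (un f p).
Proof. by rewrite !open_placed un_comp. Qed.

Lemma tiling_comp f G g :
  tiling G g -> tiling (comp f G) (fun i => comp f (g i)).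
Proof.
move=> [cov disj]; split=> [p|i j p]; last by rewrite !open_in_comp; exact: disj.
by rewrite closed_in_comp cov; split=> -[i iP]; exists i; rewrite closed_in_comp in iP *.
Qed.

Lemma tiling_turn G g : tiling G g -> tiling (turn G) (fun i => turn (g i)).
Proof.
move=> [cov disj]; split=> [[t Y]|i j p].
  rewrite closed_turn cov.
  by split=> -[i iP]; exists i; rewrite closed_turn in iP *.
rewrite !open_placed !un_turn => oi oj.
by apply: (disj i j (- p.1, - p.2)); rewrite open_placed.
Qed.

Let reg (f : sim R) : regular (placed H f) := placed_regular f pH bH.

Lemma tiling_up G g Y F : tiling G g -> upact (placed H G) Y ->
  \sum_(i | upact (placed H (g i)) Y)
     (F (hi (placed H (g i)) Y) - F (lo (placed H (g i)) Y))
  = F (hi (placed H G) Y) - F (lo (placed H G) Y).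
Proof. by move=> til aG; apply: up_sum til aG F => [|i]; exact: reg. Qed.

Lemma tiling_dn G g Y F : tiling G g -> dnact (placed H G) Y ->
  \sum_(i | dnact (placed H (g i)) Y)
     (F (hi (placed H (g i)) Y) - F (lo (placed H (g i)) Y))
  = F (hi (placed H G) Y) - F (lo (placed H G) Y).
Proof.
move=> til aG; have aG' : upact (placed H (turn G)) (- Y).
  by rewrite upact_turn opprK.
have := tiling_up (fun t => - F (- t)) (tiling_turn til) aG'.
have dn_meets K : dnact K Y -> meets K Y by move=> /asboolP[].
have [-> ->] := lo_hi_turn (reg G).2 (dn_meets _ aG); rewrite !opprK => E.
transitivity (- F (lo (placed H G) Y) + F (hi (placed H G) Y)); last by ring.
rewrite -E; apply: eq_big => [i|i ai]; first by rewrite upact_turn opprK.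
by have [-> ->] := lo_hi_turn (reg (g i)).2 (dn_meets _ ai); rewrite !opprK; ring.
Qed.

(** The slices just above and just below the line add up to the same, and the
    tiles that cross the line contribute equally to both. *)
Lemma balance G g Y F : tiling G g ->
    upact (placed H G) Y -> dnact (placed H G) Y ->
  \sum_(i | bottom (placed H (g i)) Y)
     (F (hi (placed H (g i)) Y) - F (lo (placed H (g i)) Y))
  = \sum_(i | topmost (placed H (g i)) Y)
     (F (hi (placed H (g i)) Y) - F (lo (placed H (g i)) Y)).
Proof.
move=> til uG dG; have := tiling_up F til uG; rewrite -(tiling_dn F til dG).
rewrite (bigID (fun i => dnact (placed H (g i)) Y)) /=.
rewrite [in RHS](bigID (fun i => upact (placed H (g i)) Y)) /=.
rewrite [X in _ = X + _](eq_bigl (fun i => upact (placed H (g i)) Y &&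
  dnact (placed H (g i)) Y)); last by move=> i; rewrite andbC.
exact: addrI.
Qed.

Lemma tile_dnact G g i Y : tiling G g -> dnact (placed H (g i)) Y ->
  dnact (placed H G) Y.
Proof.
move=> [cov _] /asboolP[[t mt] [p pin pY]]; apply/asboolP; split.
  by exists t; apply/cov; exists i.
by exists p => //; apply/cov; exists i.
Qed.

Lemma tile_upact G g i Y : tiling G g -> upact (placed H (g i)) Y ->
  upact (placed H G) Y.
Proof.
move=> [cov _] /asboolP[[t mt] [p pin pY]]; apply/asboolP; split.
  by exists t; apply/cov; exists i.
by exists p => //; apply/cov; exists i.
Qed.

(** A tile that reaches below the line would make the figure reach below it. *)
Lemma base_sum G g Y F : tiling G g -> bottom (placed H G) Y ->
  \sum_(i | bottom (placed H (g i)) Y)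
     (F (hi (placed H (g i)) Y) - F (lo (placed H (g i)) Y))
  = F (hi (placed H G) Y) - F (lo (placed H G) Y).
Proof.
move=> til /andP[uG dG]; rewrite -(tiling_up F til uG); apply: eq_bigl => i.
rewrite /bottom; case: (boolP (dnact (placed H (g i)) Y)); last by rewrite andbT.
by move=> /(tile_dnact til) dG'; rewrite dG' in dG.
Qed.

Lemma roof_sum G g Y F : tiling G g -> topmost (placed H G) Y ->
  \sum_(i | topmost (placed H (g i)) Y)
     (F (hi (placed H (g i)) Y) - F (lo (placed H (g i)) Y))
  = F (hi (placed H G) Y) - F (lo (placed H G) Y).
Proof.
move=> til /andP[uG dG]; rewrite -(tiling_dn F til uG); apply: eq_bigl => i.
rewrite /topmost; case: (boolP (upact (placed H (g i)) Y)); last by rewrite andbT.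
by move=> /(tile_upact til) dG'; rewrite dG' in dG.
Qed.

Lemma topmost_turn (f : sim R) Y :
  topmost (placed H f) Y = bottom (placed H (turn f)) (- Y).
Proof. by rewrite /bottom upact_turn dnact_turn opprK. Qed.

Lemma bottom_turn (f : sim R) Y :
  bottom (placed H f) Y = topmost (placed H (turn f)) (- Y).
Proof. by rewrite /topmost upact_turn dnact_turn opprK. Qed.

End Balance.

Section Trapezoid.
Variable R : realType.

(** The trapezoid with long base from [(0, 0)] to [(wid, 0)] and height [hgt],
    whose left leg has the equation [x = lsl * y] and whose right leg has
    the equation [x + rsl * y = wid].  The left leg is the long one and has
    length 1; the right leg has length [shl]. *)
Record shape := Shape {
  wid : R; hgt : R; lsl : R; rsl : R; shl : R;
  hgt_gt0 : 0 < hgt;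
  shl_gt0 : 0 < shl;
  slopes_gt0 : 0 < lsl + rsl;
  rsl_le_lsl : rsl <= lsl;
  roof_gt0 : 0 < wid - (lsl + rsl) * hgt;
  lleg_unit : hgt ^+ 2 * (1 + lsl ^+ 2) = 1;
  rleg_shl : shl ^+ 2 = hgt ^+ 2 * (1 + rsl ^+ 2) }.

Variable T : shape.
Local Notation b := (wid T).
Local Notation eta := (hgt T).
Local Notation mu := (lsl T).
Local Notation nu := (rsl T).
Local Notation h := (shl T).
Definition roof := b - (mu + nu) * eta.
Local Notation a := roof.
Implicit Types (g : sim R) (t Y z : R).

Definition sides : seq (R * R * R) :=
  [:: (0, 1, 0); (0, -1, eta); (1, - mu, 0); (-1, - nu, b)].

Definition inT (x y : R) := [&& 0 <= y, y <= eta, mu * y <= x & x + nu * y <= b].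

Lemma closed_sides p : closed_in sides p = inT p.1 p.2.
Proof.
rewrite /closed_in /= /aff /= andbT /inT.
by congr [&& _, _, _ & _]; apply/idP/idP; lra.
Qed.

Lemma closed_at g t Y : closed_in (placed sides g) (t, Y) =
  let x := sc g * (t - sx g) + ss g * (Y - sy g) in
  let y := se g * (sc g * (Y - sy g) - ss g * (t - sx g)) in
  [&& 0 <= y, y <= sk g * eta, mu * y <= x & x + nu * y <= sk g * b].
Proof.
have k0 := sk_gt0 g; rewrite closed_placed closed_sides /inT /un /=.
rewrite ler_pdivlMr // mul0r ler_pdivrMr // (mulrC eta) !mulrA.
by rewrite -mulrDl ler_pM2r ?invr_gt0 // ler_pdivrMr // (mulrC b).
Qed.

Lemma proper_sides : proper sides.
Proof.
by move=> q; rewrite !inE => /or4P[] /eqP -> /=; rewrite ?oppr_eq0 oner_eq0 ?orbT.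
Qed.

Lemma roof_pos : 0 < a. Proof. exact: roof_gt0. Qed.

Lemma wid_roof : b = a + (mu + nu) * eta.
Proof. by rewrite /a; ring. Qed.

Lemma mu_gt0 : 0 < mu.
Proof. by have := slopes_gt0 T; have := rsl_le_lsl T; lra. Qed.

Lemma wid_gt_roof : a < b.
Proof. by rewrite wid_roof ltrDl mulr_gt0 ?slopes_gt0 ?hgt_gt0. Qed.

Lemma shl_le1 : h <= 1.
Proof.
have h0 := shl_gt0 T; have s := slopes_gt0 T; have d := rsl_le_lsl T.
have : h ^+ 2 <= 1.
  rewrite rleg_shl; apply: le_trans (_ : eta ^+ 2 * (1 + mu ^+ 2) <= 1); last first.
    by rewrite lleg_unit.
  rewrite ler_pM2l ?exprn_gt0 ?hgt_gt0 // lerD2l.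
  by rewrite -subr_ge0 subr_sqr mulr_ge0 //; lra.
by rewrite expr_le1 // ltW.
Qed.

Lemma bounded_sides : bounded_poly sides.
Proof.
exists (b + (`|mu| + `|nu|) * eta + eta) => p; rewrite closed_sides.
case/and4P=> y0 ye mx xn; have e0 := hgt_gt0 T; have b0 := wid_gt_roof.
have a0 := roof_pos.
have bd (c : R) : `|c * p.2| <= `|c| * eta.
  by rewrite normrM ler_wpM2l // ger0_norm.
have := bd mu; have := bd nu; rewrite !ler_norml => /andP[n1 n2] /andP[m1 m2].
have mm : 0 <= `|mu| * eta by rewrite mulr_ge0 // ltW.
have nn : 0 <= `|nu| * eta by rewrite mulr_ge0 // ltW.
by split; apply/andP; split; lra.
Qed.

Lemma reg_placed g : regular (placed sides g).
Proof. by apply: placed_regular; [exact: proper_sides|exact: bounded_sides]. Qed.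

(** The second coordinate of the image of a point grows by [ss] along the first
    axis and by [se * sc] along the second one, up to the ratio. *)
Definition upright g := (ss g == 0) && (se g * sc g == 1).
Definition inverted g := (ss g == 0) && (se g * sc g == -1).

Lemma inverted_turn g : inverted g = upright (turn g).
Proof.
rewrite /inverted /upright /= mulrN oppr_eq0; congr (_ && _).
by rewrite eqr_oppLR.
Qed.

Lemma upright_turn g : upright g = inverted (turn g).
Proof.
rewrite /inverted /upright /= mulrN oppr_eq0; congr (_ && _).
by rewrite eqr_opp.
Qed.

Lemma upright_closed g Y : upright g -> sy g <= Y <= sy g + sk g * eta ->
  exists l, forall t, closed_in (placed sides g) (t, Y) =
    (l <= t <= l + (sk g * b - (mu + nu) * (Y - sy g))).
Proof.
move=> /andP[/eqP s0 /eqP ec] /andP[Y0 Y1]; have k0 := sk_gt0 g.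
have [e1|e1] := se_cases g; rewrite e1 in ec.
  have c1 : sc g = 1 by lra.
  exists (sx g + mu * (Y - sy g)) => t.
  by rewrite closed_at s0 c1 e1 /=; apply/and4P/andP => -[*]; split; lra.
have c1 : sc g = - 1 by lra.
exists (sx g - (sk g * b - nu * (Y - sy g))) => t.
by rewrite closed_at s0 c1 e1 /=; apply/and4P/andP => -[*]; split; lra.
Qed.

Lemma upright_range g t Y : upright g -> closed_in (placed sides g) (t, Y) ->
  sy g <= Y <= sy g + sk g * eta.
Proof.
move=> /andP[/eqP s0 /eqP ec]; have k0 := sk_gt0 g.
rewrite closed_at s0 /= mul0r subr0 (mulrA (se g)) ec mul1r => /and4P[*].
by apply/andP; split; lra.
Qed.

Lemma chord_len_gt0 g Y : sy g <= Y <= sy g + sk g * eta ->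
  0 < sk g * b - (mu + nu) * (Y - sy g).
Proof.
move=> /andP[_ Y1]; have := mulr_gt0 (sk_gt0 g) roof_pos.
have : 0 <= (mu + nu) * (sk g * eta + sy g - Y).
  by rewrite mulr_ge0 ?(ltW (slopes_gt0 T)) //; lra.
by rewrite /a; lra.
Qed.

Lemma upright_len g Y : upright g -> sy g <= Y <= sy g + sk g * eta ->
  hi (placed sides g) Y - lo (placed sides g) Y
    = sk g * b - (mu + nu) * (Y - sy g).
Proof.
move=> ug Yr; have [l E] := upright_closed ug Yr; have len := chord_len_gt0 Yr.
have [|-> ->] := lo_hi E; first by lra.
by rewrite addrAC subrr add0r.
Qed.

Lemma upright_meets g Y : upright g -> sy g <= Y <= sy g + sk g * eta ->
  meets (placed sides g) Y.
Proof.
move=> ug Yr; have [l E] := upright_closed ug Yr; have len := chord_len_gt0 Yr.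
by exists l; rewrite E lexx lerDl ltW.
Qed.

Lemma upright_up g Y : upright g ->
  upact (placed sides g) Y = (sy g <= Y < sy g + sk g * eta).
Proof.
move=> ug; have k0 := mulr_gt0 (sk_gt0 g) (hgt_gt0 T); apply/asboolP/idP.
  move=> [[t /(upright_range ug) /andP[-> _]] [[u Z] /(upright_range ug) /= Zr YZ]].
  by case/andP: Zr; lra.
move=> /andP[Y0 Y1]; split; first by apply: upright_meets => //; lra.
have [|t mt] := @upright_meets g (sy g + sk g * eta) ug; first by lra.
by exists (t, sy g + sk g * eta).
Qed.

Lemma upright_dn g Y : upright g ->
  dnact (placed sides g) Y = (sy g < Y <= sy g + sk g * eta).
Proof.
move=> ug; have k0 := mulr_gt0 (sk_gt0 g) (hgt_gt0 T); apply/asboolP/idP.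
  move=> [[t /(upright_range ug) /andP[_ ->]] [[u Z] /(upright_range ug) /= Zr YZ]].
  by case/andP: Zr; lra.
move=> /andP[Y0 Y1]; split; first by apply: upright_meets => //; lra.
have [|t mt] := @upright_meets g (sy g) ug; first by lra.
by exists (t, sy g).
Qed.

Lemma upright_bottom g Y : upright g -> bottom (placed sides g) Y = (Y == sy g).
Proof.
move=> ug; have k0 := mulr_gt0 (sk_gt0 g) (hgt_gt0 T).
rewrite /bottom upright_up // upright_dn //.
by apply/idP/eqP => [|->]; lra.
Qed.

Lemma upright_topmost g Y : upright g ->
  topmost (placed sides g) Y = (Y == sy g + sk g * eta).
Proof.
move=> ug; have k0 := mulr_gt0 (sk_gt0 g) (hgt_gt0 T).
rewrite /topmost upright_up // upright_dn //.
by apply/idP/eqP => [|->]; lra.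
Qed.

Lemma inverted_topmost g Y : inverted g ->
  topmost (placed sides g) Y = (Y == sy g).
Proof.
rewrite inverted_turn => ug; rewrite topmost_turn upright_bottom //=.
exact: eqr_opp.
Qed.

Lemma inverted_bottom g Y : inverted g ->
  bottom (placed sides g) Y = (Y == sy g - sk g * eta).
Proof.
rewrite inverted_turn => ug; rewrite bottom_turn upright_topmost //=.
by apply/eqP/eqP; lra.
Qed.

Lemma inverted_meets g Y : inverted g -> sy g - sk g * eta <= Y <= sy g ->
  meets (placed sides g) Y.
Proof.
rewrite inverted_turn => ug Yr; rewrite -[Y]opprK; apply/meets_turn.
by apply: upright_meets => //=; lra.
Qed.

Lemma inverted_len g Y : inverted g -> sy g - sk g * eta <= Y <= sy g ->
  hi (placed sides g) Y - lo (placed sides g) Y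
    = sk g * b - (mu + nu) * (sy g - Y).
Proof.
move=> ig Yr; have mg := inverted_meets ig Yr.
have [E1 E2] := lo_hi_turn (reg_placed g).2 mg.
have Yr' : sy (turn g) <= - Y <= sy (turn g) + sk (turn g) * eta.
  by rewrite /=; lra.
have := ig; rewrite inverted_turn => /upright_len/(_ Yr'); rewrite E1 E2.
by rewrite -[sy _]/(- sy g) -[sk _]/(sk g); lra.
Qed.

End Trapezoid.

(** * The sides of a tile and their weights *)

Section Faces.
Variables (R : realType) (T : shape R).
Local Notation b := (wid T).
Local Notation eta := (hgt T).
Local Notation mu := (lsl T).
Local Notation nu := (rsl T).
Local Notation h := (shl T).
Local Notation a := (roof T).
Local Notation tile g := (placed (sides T) g).
Implicit Types (g : sim R) (t Y z : R).

(** The conditions say that the inner normal of the leg points upwards. *)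
Definition on_left_leg g := (ss g == eta) && (se g * sc g == - (eta * mu)).
Definition on_right_leg g :=
  (ss g == - (eta / h)) && (se g * sc g == - (eta / h * nu)).

(** Close to a line that contains one of its legs, a tile looks like a
    parallelogram: its slices have the length of the leg and drift at the rate
    [drift] given by the slope of its bases. *)
Definition leg_chords g Y0 L drift len := forall z,
  0 <= z <= sk g * eta * a -> forall t,
  closed_in (tile g) (t, Y0 + z) = (L + drift * z <= t <= L + drift * z + len).

Lemma leg_lo_hi g Y L d len z : leg_chords g Y L d len -> 0 <= len ->
    0 <= z <= sk g * eta * a ->
  lo (tile g) (Y + z) = L + d * z /\ hi (tile g) (Y + z) = L + d * z + len.
Proof. by move=> E l0 /E/lo_hi; apply; rewrite lerDl. Qed.

Lemma leg_range0 g : 0 <= (0 : R) <= sk g * eta * a.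
Proof.
by rewrite lexx /= !mulr_ge0 ?ltW ?sk_gt0 ?hgt_gt0 ?roof_pos.
Qed.

Lemma left_leg_chords g : on_left_leg g ->
  leg_chords g (sy g) (sx g - (if se g == 1 then sk g else 0))
    (- (se g * mu)) (sk g).
Proof.
move=> /andP[/eqP s0 /eqP ec]; have k0 := sk_gt0 g; have e0 := hgt_gt0 T.
move=> z /andP[z0 z1] t.
pose tau := - (se g * (t - sx g)) - mu * z.
have ->: closed_in (tile g) (t, sy g + z) = (0 <= tau <= sk g).
  rewrite closed_at s0 /=.
  have yE : se g * (sc g * (sy g + z - sy g) - eta * (t - sx g)) = eta * tau.
    transitivity ((se g * sc g) * z - se g * eta * (t - sx g)); first by ring.
    by rewrite ec /tau; ring.
  have xE : sc g * (t - sx g) + eta * (sy g + z - sy g) = mu * (eta * tau) + z / eta.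
    transitivity (se g ^+ 2 * sc g * (t - sx g) + eta * z).
      by rewrite se_sq; ring.
    transitivity ((se g * sc g) * se g * (t - sx g) + eta * z); first by ring.
    rewrite ec /tau -[z / eta]mul1r -[X in _ + X * (z / eta)](lleg_unit T).
    by field; exact: lt0r_neq0.
  rewrite yE xE; have ze0 : 0 <= z / eta by rewrite divr_ge0 // ltW.
  have zea : z / eta <= sk g * a by rewrite ler_pdivrMr // mulrAC.
  rewrite pmulr_rge0 // (mulrC (sk g)) ler_pM2l // lerDl ze0 /=.
  case: (boolP (0 <= tau)) => //= t0; case: (boolP (tau <= sk g)) => //= t1.
  have : (mu + nu) * (eta * tau) <= (mu + nu) * (eta * sk g).
    by rewrite ler_pM2l ?slopes_gt0 // ler_pM2l.
  by move: zea; rewrite /roof; lra.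
have [e1|e1] := se_cases g; rewrite /tau e1 ?eqxx.
  by apply/idP/idP; lra.
have -> : (-1 == 1 :> R) = false by apply/negbTE/eqP; lra.
by apply/idP/idP; lra.
Qed.

Lemma right_leg_chords g : on_right_leg g ->
  leg_chords g (sy g - sk g * b * (eta / h))
    (sx g - se g * nu * (sk g * b * (eta / h)) - (if se g == 1 then 0 else sk g * h))
    (se g * nu) (sk g * h).
Proof.
move=> /andP[/eqP s0 /eqP ec]; have k0 := sk_gt0 g; have e0 := hgt_gt0 T.
have h0 := shl_gt0 T; set sg := eta / h in s0 ec *.
have sg0 : 0 < sg by rewrite divr_gt0.
have sgh : sg * h = eta by rewrite /sg divfK // lt0r_neq0.
have sg1 : sg ^+ 2 * (1 + nu ^+ 2) = 1.
  rewrite /sg expr_div_n mulrAC -rleg_shl divff // expf_neq0 //.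
  exact: lt0r_neq0.
pose w0 := sk g * b * sg.
rewrite -/w0.
move=> z /andP[z0 z1] t.
pose tau := se g * (t - sx g) - nu * (z - w0).
have ->: closed_in (tile g) (t, sy g - sk g * b * sg + z) =
    (0 <= tau <= sk g * h).
  rewrite closed_at s0 /=.
  have yE : se g * (sc g * (sy g - sk g * b * sg + z - sy g) - - sg * (t - sx g))
      = sg * tau.
    transitivity ((se g * sc g) * (z - w0) + se g * sg * (t - sx g)).
      by rewrite /w0; ring.
    by rewrite ec /tau; ring.
  have xE : sc g * (t - sx g) + - sg * (sy g - sk g * b * sg + z - sy g)
      = sk g * b - sg * (1 + nu ^+ 2) * z - nu * (sg * tau).
    transitivity (se g ^+ 2 * sc g * (t - sx g) - sg * (z - w0)).
      by rewrite se_sq /w0; ring.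
    transitivity ((se g * sc g) * se g * (t - sx g) - sg * (z - w0)).
      by ring.
    rewrite ec -[X in X - _ - _]mulr1 -[X in _ = _ * X - _ - _]sg1 /tau /w0; ring.
  have rho0 : 0 <= sg * (1 + nu ^+ 2).
    by rewrite mulr_ge0 ?(ltW sg0) // addr_ge0 ?sqr_ge0.
  rewrite yE xE; have ze0 : 0 <= sg * (1 + nu ^+ 2) * z by rewrite mulr_ge0.
  have zea : sg * (1 + nu ^+ 2) * z <= sk g * a.
    have : sg * (1 + nu ^+ 2) * z <= sg * (1 + nu ^+ 2) * (sk g * eta * a).
      by rewrite ler_wpM2l.
    move=> /le_trans; apply.
    have -> : sg * (1 + nu ^+ 2) * (sk g * eta * a) = h * (sk g * a).
      rewrite -[RHS]mulr1 -[X in _ = _ * X]sg1 -sgh; ring.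
    by rewrite ler_piMl ?shl_le1 // mulr_ge0 ?(ltW k0) // ltW // roof_pos.
  have -> : (sg * tau <= sk g * eta) = (tau <= sk g * h).
    by rewrite -sgh mulrCA ler_pM2l.
  rewrite pmulr_rge0 //.
  case: (boolP (0 <= tau)) => //= t0; case: (boolP (tau <= sk g * h)) => //= t1.
  have : (mu + nu) * (sg * tau) <= (mu + nu) * (sg * (sk g * h)).
    by rewrite ler_pM2l ?slopes_gt0 // ler_pM2l.
  by move: zea; rewrite /roof -sgh; lra.
have [e1|e1] := se_cases g; rewrite /tau e1 ?eqxx.
  by apply/idP/idP; lra.
have -> : (-1 == 1 :> R) = false by apply/negbTE/eqP; lra.
by apply/idP/idP; lra.
Qed.

(** If no side were tight at the midpoint of the lowest slice, the polygon would
    continue below it.  A side that is tight at an inner point of the slice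
    contains the whole slice. *)
Lemma bottom_side (H : seq (R * R * R)) Y : regular H -> bottom H Y ->
  lo H Y < hi H Y ->
  exists2 q, q \in H & [/\ q.1.1 = 0, 0 < q.1.2 & q.1.2 * Y + q.2 = 0].
Proof.
move=> [pH bH] /andP[/asboolP[mH [p pin Yp]] nd] lth.
have [lh E] := chordP bH mH.
pose m := (lo H Y + hi H Y) / 2.
have min : closed_in H (m, Y) by rewrite E /m; lra.
have [q qH q0] : exists2 q, q \in H & aff q (m, Y) = 0.
  apply/not_exists2P => nz; case/negP: nd; apply/asboolP; split => //.
  have : \forall z \near (0 : R)^'+, forall q, q \in H -> 0 < aff q (m, Y) + (- q.1.2) * z.
    apply: near0_all => q qH; apply: near0_affine.
    rewrite lt_def (allP min _ qH) andbT; apply/eqP.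
    by have [] := nz q.
  move=> /(filterI (nbhs_right_gt 0))/filter_ex[z [z0 zin]].
  exists (m, Y - z) => /=; last by lra.
  apply/allP => q qH; apply: ltW; have := zin q qH.
  by rewrite /aff /=; congr (0 < _); ring.
exists q => //.
have /allP/(_ q qH) /= ql : closed_in H (lo H Y, Y) by rewrite E lexx.
have /allP/(_ q qH) /= qh : closed_in H (hi H Y, Y) by rewrite E lexx lh.
have qp : 0 <= aff q p := allP pin q qH.
have u0 : q.1.1 = 0.
  have : q.1.1 * (hi H Y - lo H Y) = 0.
    by move: q0 ql qh; rewrite /aff /m /=; lra.
  by move/eqP; rewrite mulf_eq0 subr_eq0 (gt_eqF lth) orbF => /eqP.
move: q0 qp (pH q qH); rewrite /aff /= u0 eqxx /= => q0 qp vn.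
split=> //; last by lra.
rewrite lt_def vn -(@pmulr_lge0 _ (p.2 - Y)) ?subr_gt0 //; lra.
Qed.

(** A horizontal side with the polygon above it determines the linear part of the
    placement up to a reflection. *)
Lemma sides_bottom g Y : bottom (tile g) Y -> lo (tile g) Y < hi (tile g) Y ->
  [\/ upright g, inverted g, on_left_leg g /\ Y = sy g |
      on_right_leg g /\ Y = sy g - sk g * b * (eta / h)].
Proof.
move=> bot lth; have k0 := sk_gt0 g; have e0 := hgt_gt0 T; have h0 := shl_gt0 T.
have cs := sc_ss g; have ee := se_sq g.
have ec2 : (se g * sc g) ^+ 2 + ss g ^+ 2 = 1 by rewrite exprMn ee mul1r.
have [_ /mapP[q qs ->]] := bottom_side (reg_placed T g) bot lth.
rewrite /pull /=; set u := (_ / _); set v := (_ / _) => -[u0 v0 Y0].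
have ku : sk g * u = q.1.1 * sc g - q.1.2 * se g * ss g.
  by rewrite /u mulrC divfK // lt0r_neq0.
have kv : sk g * v = q.1.1 * ss g + q.1.2 * se g * sc g.
  by rewrite /v mulrC divfK // lt0r_neq0.
have kv0 : 0 < sk g * v by rewrite mulr_gt0.
have YE : v * (Y - sy g) = - q.2 by move: Y0; rewrite u0; lra.
rewrite u0 mulr0 in ku; clearbody u v; clear u u0 Y0 bot lth.
have eu : se g * (q.1.1 * sc g - q.1.2 * se g * ss g) = 0 by rewrite -ku mulr0.
have {}eu : q.1.1 * (se g * sc g) = q.1.2 * ss g.
  transitivity (q.1.2 * se g ^+ 2 * ss g); last by rewrite ee mulr1.
  by move: eu; lra.
rewrite -mulrA in kv; set B := se g * sc g in ec2 kv eu *.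
move: qs; rewrite !inE => /or4P[] /eqP qE; rewrite {}qE /= in eu kv YE.
- apply: Or41; rewrite /upright -/B; have s0 : ss g = 0 by lra.
  rewrite s0 eqxx /=; apply/eqP; move: ec2; rewrite s0 => /eqP.
  rewrite expr0n addr0 sqrf_eq1 => /orP[/eqP //|/eqP B1]; lra.
- apply: Or42; rewrite /inverted -/B; have s0 : ss g = 0 by lra.
  rewrite s0 eqxx /=; apply/eqP; move: ec2; rewrite s0 => /eqP.
  rewrite expr0n addr0 sqrf_eq1 => /orP[/eqP B1|/eqP //]; lra.
- apply: Or43; have BE : B = - (mu * ss g) by lra.
  have mu2 : 0 < 1 + mu ^+ 2 by rewrite ltr_pwDl ?ltr01 ?sqr_ge0.
  have s0 : 0 < ss g.
    by rewrite -(@pmulr_lgt0 _ (1 + mu ^+ 2)) //; move: kv0; rewrite kv BE; lra.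
  have sE : ss g = eta.
    apply/eqP; rewrite -(@eqrXn2 _ 2) ?ltW //; apply/eqP.
    apply: (mulIf (lt0r_neq0 mu2)); rewrite lleg_unit -[RHS]ec2 BE; ring.
  split; first by rewrite /on_left_leg -/B BE sE mulrC !eqxx.
  move/eqP: YE; rewrite oppr0 mulf_eq0 subr_eq0 => /orP[/eqP v00|/eqP//].
  by move: kv0; rewrite v00 mulr0 ltxx.
apply: Or44; have BE : B = nu * ss g by lra.
have nu2 : 0 < 1 + nu ^+ 2 by rewrite ltr_pwDl ?ltr01 ?sqr_ge0.
have kvE : sk g * v = - ss g * (1 + nu ^+ 2) by rewrite kv BE; ring.
have s0 : 0 < - ss g by rewrite -(@pmulr_lgt0 _ (1 + nu ^+ 2)) // -kvE.
have s2 : ss g ^+ 2 * (1 + nu ^+ 2) = 1 by rewrite -[RHS]ec2 BE; ring.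
have sE : - ss g = eta / h.
  apply/eqP; rewrite -(@eqrXn2 _ 2) ?divr_ge0 ?ltW //; apply/eqP.
  apply: (mulIf (lt0r_neq0 nu2)); rewrite sqrrN s2 expr_div_n mulrAC -rleg_shl.
  by rewrite divff // expf_neq0 // lt0r_neq0.
split.
  by rewrite /on_right_leg -/B -sE opprK BE eqxx mulNr opprK (mulrC nu) eqxx.
have kvn : sk g * v != 0 by exact: lt0r_neq0.
suff : Y - sy g = - (sk g * b * (eta / h)) by lra.
apply: (mulfI kvn); rewrite -[LHS]mulrA YE -sE kvE.
transitivity (- (sk g * b * (ss g ^+ 2 * (1 + nu ^+ 2)))); last by ring.
by rewrite s2 mulr1 mulrN.
Qed.

(** The lengths of the sides of a tile of ratio [k] enter the argument only
    through a function that has both legs as periods and that increases by [wa]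
    and [wb] along the two bases. *)
Definition side_weights k (F : R -> R) wa wb :=
  [/\ forall t, F (t + k) = F t, forall t, F (t + k * h) = F t,
      forall t, F (t + k * a) = F t + wa & forall t, F (t + k * b) = F t + wb].

(** The weight of the lowest slice of a tile; legs and single points weigh
    nothing.  For the highest slice, exchange [wa] and [wb]. *)
Definition gain wa wb g : R :=
  if upright g then wb else if inverted g then wa else 0.

Lemma bottom_gain g Y F wa wb : side_weights (sk g) F wa wb ->
    bottom (tile g) Y ->
  F (hi (tile g) Y) - F (lo (tile g) Y) = gain wa wb g.
Proof.
move=> [F1 Fh Fa Fb] bot; have k0 := sk_gt0 g; have e0 := hgt_gt0 T.
have h0 := shl_gt0 T; have ke : 0 < sk g * eta by rewrite mulr_gt0.
have mY : meets (tile g) Y by move: bot => /andP[/upact_meets].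
have [lh _] := chordP (reg_placed T g).2 mY.
have shift l len : hi (tile g) Y - lo (tile g) Y = len ->
    (forall t, F (t + len) = F t + l) -> F (hi (tile g) Y) - F (lo (tile g) Y) = l.
  by move=> <- /(_ (lo (tile g) Y)); rewrite addrC subrK => ->; rewrite addrAC subrr add0r.
rewrite /gain; case: (boolP (upright g)) => [ug|nu].
  apply: (shift _ (sk g * b)) => //; move: bot; rewrite upright_bottom // => /eqP ->.
  by rewrite upright_len ?subrr ?mulr0 ?subr0 // lexx lerDl ltW.
case: (boolP (inverted g)) => [ig|ni].
  apply: (shift _ (sk g * a)) => //; move: bot; rewrite inverted_bottom // => /eqP ->.
  rewrite inverted_len //; first by rewrite /roof; ring.
  by rewrite lexx gerBl ltW.
move: lh; rewrite le_eqVlt => /predU1P[->|lth]; first by rewrite subrr.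
have [||[lg YE]|[lg YE]] := sides_bottom bot lth.
- by rewrite (negbTE nu).
- by rewrite (negbTE ni).
- apply: (shift _ (sk g)) => [|t]; last by rewrite addr0.
  have := leg_lo_hi (left_leg_chords lg) (ltW k0) (leg_range0 g); rewrite addr0 -YE.
  by move=> [-> ->]; lra.
apply: (shift _ (sk g * h)) => [|t]; last by rewrite addr0.
have kh0 : 0 <= sk g * h by rewrite mulr_ge0 // ltW.
have := leg_lo_hi (right_leg_chords lg) kh0 (leg_range0 g); rewrite addr0 -YE.
by move=> [-> ->]; lra.
Qed.

Lemma topmost_gain g Y F wa wb : side_weights (sk g) F wa wb ->
    topmost (tile g) Y ->
  F (hi (tile g) Y) - F (lo (tile g) Y) = gain wb wa g.
Proof.
move=> [F1 Fh Fa Fb] top; have bot := top; rewrite topmost_turn in bot.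
pose F' t := - F (- t).
have FK t c w : (forall u, F (u + c) = F u + w) -> F' (t + c) = F' t + w.
  by move=> Fc; rewrite /F'; have := Fc (- (t + c)); rewrite opprD subrK; lra.
have F'w : side_weights (sk (turn g)) F' wa wb.
  split=> t; try exact: FK.
    by rewrite (FK _ _ 0) ?addr0 // => u; rewrite F1 addr0.
  by rewrite (FK _ _ 0) ?addr0 // => u; rewrite Fh addr0.
have := bottom_gain F'w bot.
have mY : meets (tile g) Y by move: top => /andP[/asboolP[]].
have [-> ->] := lo_hi_turn (reg_placed T g).2 mY; rewrite /F' !opprK /gain.
rewrite -inverted_turn -upright_turn => E.
transitivity (- F (lo (tile g) Y) + F (hi (tile g) Y)); first by ring.
rewrite E; case: (boolP (upright g)) => // /andP[_ /eqP ug].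
by case: (boolP (inverted g)) => // /andP[_ /eqP ig]; lra.
Qed.

End Faces.

(** * Positive weights *)

Section Flow.
Variables (R : realType) (T : shape R) (I : finType) (n : nat).
Hypothesis n_ge2 : (2 <= n)%N.
Local Notation b := (wid T).
Local Notation eta := (hgt T).
Local Notation mu := (lsl T).
Local Notation nu := (rsl T).
Local Notation h := (shl T).
Local Notation a := (roof T).
Local Notation tile g := (placed (sides T) g).
Local Notation k := (n%:R^-1 : R).
Local Notation tiles := (tiling (sides T)).
Implicit Types (G f : sim R) (g : I -> sim R) (F : R -> R) (Y : R).

Lemma nR_gt0 : 0 < (n%:R : R).
Proof. by rewrite ltr0n; case: n n_ge2. Qed.

Lemma k_gt0 : 0 < k. Proof. by rewrite invr_gt0 nR_gt0. Qed.

Lemma nk1 : n%:R * k = 1.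
Proof. by rewrite divff // lt0r_neq0 // nR_gt0. Qed.

Lemma k_half : k <= 2^-1.
Proof. by rewrite lef_pV2 ?posrE ?nR_gt0 ?ltr0n // ler_nat. Qed.

Lemma k_lt1 : k < 1.
Proof. by have := k_half; lra. Qed.

Definition horizontal f := ss f == 0.

Lemma horizontal_cases f : horizontal f -> upright f \/ inverted f.
Proof.
rewrite /horizontal /upright /inverted => s0; have /eqP := sc_ss f.
rewrite (eqP s0) eqxx expr0n addr0 => /eqP cc.
have /eqP : (se f * sc f) ^+ 2 = 1 by rewrite exprMn se_sq cc mulr1.
by rewrite sqrf_eq1 => /orP[]; [left|right].
Qed.

Lemma upright_horizontal f : upright f -> horizontal f.
Proof. by case/andP. Qed.

Lemma inverted_horizontal f : inverted f -> horizontal f.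
Proof. by case/andP. Qed.

Lemma inverted_not_upright f : inverted f -> upright f = false.
Proof.
by move=> /andP[_ /eqP i1]; apply/negP => /andP[_ /eqP]; rewrite i1; lra.
Qed.

Lemma gain_upright wa wb f : upright f -> gain wa wb f = wb.
Proof. by rewrite /gain => ->. Qed.

Lemma gain_inverted wa wb f : inverted f -> gain wa wb f = wa.
Proof. by rewrite /gain => i; rewrite inverted_not_upright // i. Qed.

Lemma gain_slanted wa wb f : ~~ horizontal f -> gain wa wb f = 0.
Proof.
rewrite /gain => nh; rewrite (contraNF (@upright_horizontal f) nh).
by rewrite (contraNF (@inverted_horizontal f) nh).
Qed.

Section Weighted.
Variables (F : R -> R) (wa wb : R).
Hypothesis Fw : side_weights T k F wa wb.

Lemma weights_iter c w : (forall t, F (t + c) = F t + w) ->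
  forall m t, F (t + m%:R * c) = F t + m%:R * w.
Proof.
move=> Fc; elim=> [|m IH] t; first by rewrite !mul0r !addr0.
by rewrite -natr1 !mulrDl !mul1r !addrA Fc IH.
Qed.

Lemma weights_unit : side_weights T 1 F (n%:R * wa) (n%:R * wb).
Proof.
have E c : n%:R * (k * c) = 1 * c by rewrite mulrA nk1.
case: Fw => F1 Fh Fa Fb; split=> t.
- have := @weights_iter k 0 _ n t; rewrite nk1 mulr0 addr0; apply => u.
  by rewrite F1 addr0.
- have := @weights_iter (k * h) 0 _ n t; rewrite E mulr0 addr0; apply => u.
  by rewrite Fh addr0.
- by have := weights_iter Fa n t; rewrite E.
- by have := weights_iter Fb n t; rewrite E.
Qed.

Variables (G : sim R) (g : I -> sim R).
Hypotheses (til : tiles G g) (skG : sk G = 1) (skg : forall i, sk (g i) = k).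

Let weights_G : side_weights T (sk G) F (n%:R * wa) (n%:R * wb).
Proof. by rewrite skG; exact: weights_unit. Qed.

Let weights_g i : side_weights T (sk (g i)) F wa wb.
Proof. by rewrite skg. Qed.

Lemma flow Y : upact (tile G) Y -> dnact (tile G) Y ->
  \sum_(i | bottom (tile (g i)) Y) gain wa wb (g i)
  = \sum_(i | topmost (tile (g i)) Y) gain wb wa (g i).
Proof.
move=> uG dG.
have := balance (@proper_sides R T) (@bounded_sides R T) F til uG dG.
rewrite (eq_bigr (fun i => gain wa wb (g i))) => [->|i bi]; last first.
  exact: bottom_gain (weights_g i) bi.
by apply: eq_bigr => i ti; exact: topmost_gain (weights_g i) ti.
Qed.

Lemma flow_base Y : bottom (tile G) Y ->
  \sum_(i | bottom (tile (g i)) Y) gain wa wb (g i)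
  = gain (n%:R * wa) (n%:R * wb) G.
Proof.
move=> bG; rewrite -(bottom_gain weights_G bG).
rewrite -(base_sum (@proper_sides R T) (@bounded_sides R T) F til bG).
by apply: eq_bigr => i bi; rewrite (bottom_gain (weights_g i) bi).
Qed.

Lemma flow_roof Y : topmost (tile G) Y ->
  \sum_(i | topmost (tile (g i)) Y) gain wb wa (g i)
  = gain (n%:R * wb) (n%:R * wa) G.
Proof.
move=> tG; rewrite -(topmost_gain weights_G tG).
rewrite -(roof_sum (@proper_sides R T) (@bounded_sides R T) F til tG).
by apply: eq_bigr => i bi; rewrite (topmost_gain (weights_g i) bi).
Qed.

Definition base_height f := if upright f then sy f else sy f - sk f * eta.

Lemma bottom_horizontal f Y : horizontal f ->
  bottom (tile f) Y = (Y == base_height f).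
Proof.
case/horizontal_cases => fP; rewrite /base_height.
  by rewrite fP upright_bottom.
by rewrite (inverted_not_upright fP) inverted_bottom.
Qed.

Lemma topmost_horizontal f Y : horizontal f ->
  topmost (tile f) Y = (Y == base_height f + sk f * eta).
Proof.
case/horizontal_cases => fP; rewrite /base_height.
  by rewrite fP upright_topmost.
by rewrite (inverted_not_upright fP) subrK inverted_topmost.
Qed.

Hypotheses (wa0 : 0 < wa) (wb0 : 0 < wb).

Lemma gain_gt0 f : horizontal f -> 0 < gain wa wb f /\ 0 < gain wb wa f.
Proof.
by case/horizontal_cases => fP; rewrite ?(gain_upright _ _ fP) ?(gain_inverted _ _ fP).
Qed.

Lemma gain_ge0 f : 0 <= gain wa wb f.
Proof.
have [/gain_gt0[/ltW //]|nh] := boolP (horizontal f).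
by rewrite gain_slanted.
Qed.

Lemma bottom_flow_gt0 i : horizontal (g i) ->
  0 < \sum_(j | bottom (tile (g j)) (base_height (g i))) gain wa wb (g j).
Proof.
move=> hi; rewrite (bigD1 i) /=; last by rewrite bottom_horizontal.
by rewrite ltr_pwDl ?(gain_gt0 hi).1 // sumr_ge0 // => j _; exact: gain_ge0.
Qed.

(** The lower base of the tile carries a positive weight, which must be matched
    by the upper bases of tiles on the other side of its line. *)
Lemma tile_below i : horizontal (g i) -> dnact (tile G) (base_height (g i)) ->
  exists2 j, horizontal (g j) & base_height (g j) + k * eta = base_height (g i).
Proof.
move=> hi dG.
have bi : bottom (tile (g i)) (base_height (g i)) by rewrite bottom_horizontal.
have uG : upact (tile G) (base_height (g i)).
  by apply: (tile_upact til (i := i)); case/andP: bi.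
have := bottom_flow_gt0 hi; rewrite (flow uG dG).
case: (boolP [exists j, horizontal (g j) && topmost (tile (g j)) (base_height (g i))]).
  move=> /existsP[j /andP[hj]]; rewrite topmost_horizontal // skg => /eqP E _.
  by exists j.
move=> /existsPn nj; rewrite big1 ?ltxx // => j tj; rewrite gain_slanted //.
by have := nj j; rewrite tj andbT.
Qed.

(** The lowest tile with horizontal bases would rest neither on the boundary of
    the figure, which has no weight in the horizontal direction, nor on another
    such tile. *)
Lemma slanted_figure_slanted_tiles : ~~ horizontal G ->
  forall i, ~~ horizontal (g i).
Proof.
move=> nG i; apply/negP => hi.
have [m hm mmin] := @arg_minP _ _ _ i (fun j => horizontal (g j))
  (fun j => base_height (g j)) hi.
have bm : bottom (tile (g m)) (base_height (g m)) by rewrite bottom_horizontal.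
have uG : upact (tile G) (base_height (g m)).
  by apply: (tile_upact til (i := m)); case/andP: bm.
have [dG|ndG] := boolP (dnact (tile G) (base_height (g m))).
  have [j hj jm] := tile_below hm dG; have := mmin j hj; rewrite -jm /=.
  by have := mulr_gt0 k_gt0 (hgt_gt0 T); lra.
have bG : bottom (tile G) (base_height (g m)) by rewrite /bottom uG.
by have := bottom_flow_gt0 hm; rewrite (flow_base bG) gain_slanted ?ltxx.
Qed.

End Weighted.
End Flow.

Section Core.
Variables (R : realType) (T : shape R) (I : finType) (n : nat).
Hypothesis n_ge2 : (2 <= n)%N.
Local Notation b := (wid T).
Local Notation eta := (hgt T).
Local Notation mu := (lsl T).
Local Notation nu := (rsl T).
Local Notation h := (shl T).
Local Notation a := (roof T).
Local Notation tile g := (placed (sides T) g).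
Local Notation k := (n%:R^-1 : R).
Local Notation tiles := (tiling (sides T)).

Lemma idcs : (1 : R) ^+ 2 + 0 ^+ 2 = 1.
Proof. by rewrite expr1n expr0n addr0. Qed.

Definition ids : sim R := rot idcs.

Variable g : I -> sim R.
Hypotheses (til : tiles ids g) (skg : forall i, sk (g i) = k).

Let n0 := nR_gt0 R n_ge2.
Let k0 := k_gt0 R n_ge2.
Let nk := nk1 R n_ge2.
Let kh := k_half R n_ge2.
Let e0 := hgt_gt0 T.

Lemma ids_upright : upright ids.
Proof. by rewrite /upright /= mul1r !eqxx. Qed.

Lemma ids_up Y : upact (tile ids) Y = (0 <= Y < eta).
Proof. by rewrite upright_up ?ids_upright //= mul1r add0r. Qed.

Lemma ids_dn Y : dnact (tile ids) Y = (0 < Y <= eta).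
Proof. by rewrite upright_dn ?ids_upright //= mul1r add0r. Qed.

Lemma ids_len Y : 0 <= Y <= eta ->
  hi (tile ids) Y - lo (tile ids) Y = b - (mu + nu) * Y.
Proof.
have := @upright_len R T ids Y ids_upright.
by rewrite -[sy ids]/0 -[sk ids]/1 !mul1r add0r subr0 => E /E.
Qed.

Lemma tile_len_ge0 f Y : meets (tile f) Y -> 0 <= hi (tile f) Y - lo (tile f) Y.
Proof. by move=> mf; have [] := chordP (reg_placed T f).2 mf; rewrite subr_ge0. Qed.

Lemma ke_gt0 : 0 < k * eta. Proof. by rewrite mulr_gt0. Qed.

Lemma ke_le : k * eta <= 2^-1 * eta. Proof. by rewrite ler_pM2r. Qed.

Section Positive.
Variables (F : R -> R) (wa wb : R).
Hypotheses (Fw : side_weights T k F wa wb) (wa0 : 0 < wa) (wb0 : 0 < wb).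

(** Otherwise, rotate the picture until the bases of the tile are horizontal:
    this slants the figure. *)
Lemma all_horizontal i : horizontal (g i).
Proof.
have cs : sc (g i) ^+ 2 + (- ss (g i)) ^+ 2 = 1 by rewrite sqrrN sc_ss.
have til' := tiling_comp (rot cs) til.
apply/negPn/negP => nh.
have nG : ~~ horizontal (comp (rot cs) ids).
  by move: nh; rewrite /horizontal /= mulr1 mulr0 addr0 oppr_eq0.
have sG : sk (comp (rot cs) ids) = 1 by rewrite /= mulr1.
have sg j : sk (comp (rot cs) (g j)) = k by rewrite /= mul1r.
have /negP := slanted_figure_slanted_tiles n_ge2 Fw til' sG sg wa0 wb0 nG i.
by apply; rewrite /horizontal /= mul1r mulNr mulrC addrC subrr.
Qed.

(** Descend from tile to tile until the base of the figure is reached. *)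
Lemma base_level i : exists m : nat, base_height T (g i) = m%:R * (k * eta).
Proof.
have ke := ke_gt0.
have base_in j : 0 <= base_height T (g j) < eta.
  rewrite -ids_up; apply: (tile_upact til (i := j)).
  have : bottom (tile (g j)) (base_height T (g j)) by rewrite bottom_horizontal ?all_horizontal.
  by case/andP.
suff lev m : forall j, base_height T (g j) < m%:R * (k * eta) ->
    exists m : nat, base_height T (g j) = m%:R * (k * eta).
  apply: (lev n); rewrite mulrA nk mul1r; by case/andP: (base_in i).
elim: m => [j|m IH j jm]; first by have := base_in j; rewrite mul0r; lra.
have /andP[j0 je] := base_in j; move: j0; rewrite le_eqVlt => /predU1P[<-|j0].
  by exists 0; rewrite mul0r.
have dj : dnact (tile ids) (base_height T (g j)) by rewrite ids_dn j0 ltW.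
have [l hl lj] := tile_below Fw til skg wa0 wb0 (all_horizontal j) dj.
have [|m' E] := IH l; first by move: jm; rewrite -natr1 -lj mulrDl; lra.
by exists m'.+1; rewrite -lj E -natr1 mulrDl mul1r.
Qed.

Lemma base_between i (m : nat) :
    m%:R * (k * eta) - k * eta < base_height T (g i) < m%:R * (k * eta) + k * eta ->
  base_height T (g i) = m%:R * (k * eta).
Proof.
have ke := ke_gt0; have [m' ->] := base_level i.
move=> /andP[l1 l2].
have : (m%:R : R) < m'.+1%:R by rewrite -(ltr_pM2r ke) -natr1 mulrDl mul1r; lra.
have : (m'%:R : R) < m.+1%:R by rewrite -(ltr_pM2r ke) -natr1 mulrDl mul1r; lra.
rewrite !ltr_nat !ltnS => m1 m2.
by congr (_%:R * _); apply/eqP; rewrite eqn_leq m1 m2.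
Qed.

Definition layer (m : nat) : pred I := fun i => base_height T (g i) == m%:R * (k * eta).
Definition ups m := #|[pred i | layer m i && upright (g i)]|.
Definition downs m := #|[pred i | layer m i && ~~ upright (g i)]|.

Lemma layer_sum m (x y : R) :
  \sum_(i | layer m i) (if upright (g i) then x else y)
  = (ups m)%:R * x + (downs m)%:R * y.
Proof.
rewrite (bigID (fun i => upright (g i))) /=; congr (_ + _).
  rewrite (eq_bigr (fun=> x)) => [|i /andP[_ ->]] //.
  by rewrite sumr_const mulr_natl.
rewrite (eq_bigr (fun=> y)) => [|i /andP[_ /negbTE ->]] //.
by rewrite sumr_const mulr_natl.
Qed.

Lemma horizontal_act i Y :
  (upact (tile (g i)) Y = (base_height T (g i) <= Y < base_height T (g i) + k * eta)) *
  (dnact (tile (g i)) Y = (base_height T (g i) < Y <= base_height T (g i) + k * eta)).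
Proof.
rewrite -(skg i); case: (horizontal_cases (all_horizontal i)) => iP.
  by rewrite upright_up // upright_dn // /base_height iP.
have := iP; rewrite inverted_turn => tP.
have -> : upact (tile (g i)) Y = dnact (tile (turn (g i))) (- Y).
  by rewrite dnact_turn opprK.
have -> : dnact (tile (g i)) Y = upact (tile (turn (g i))) (- Y).
  by rewrite upact_turn opprK.
rewrite upright_up // upright_dn //= /base_height (inverted_not_upright iP).
by split; apply/idP/idP; lra.
Qed.

Lemma horizontal_len i :
  (hi (tile (g i)) (base_height T (g i)) - lo (tile (g i)) (base_height T (g i))
     = if upright (g i) then k * b else k * a) *
  (hi (tile (g i)) (base_height T (g i) + k * eta) - lo (tile (g i)) (base_height T (g i) + k * eta)
     = if upright (g i) then k * a else k * b).
Proof.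
have ke := ke_gt0.
rewrite -(skg i) in ke *; case: (horizontal_cases (all_horizontal i)) => iP.
  rewrite /base_height iP !upright_len //; try by lra.
  by rewrite /roof; split; ring.
rewrite /base_height (inverted_not_upright iP) subrK !inverted_len //; try by lra.
by rewrite /roof; split; ring.
Qed.

Lemma layer_low m : (m < n)%N ->
  (ups m)%:R * (k * b) + (downs m)%:R * (k * a) = b - (mu + nu) * (m%:R * (k * eta)).
Proof.
move=> mn; have ke := ke_gt0.
have Ym : 0 <= m%:R * (k * eta) < eta.
  by rewrite mulr_ge0 ?(ltW ke) //= mulrA gtr_pMl // ltr_pdivrMr // mul1r ltr_nat.
rewrite -ids_len; last by case/andP: Ym => -> /ltW.
have uG : upact (tile ids) (m%:R * (k * eta)) by rewrite ids_up.
rewrite -(tiling_up (@proper_sides R T) (@bounded_sides R T) id til uG) -layer_sum.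
rewrite [RHS](eq_bigl (layer m)) => [|i].
  by apply: eq_bigr => i /eqP <-; rewrite horizontal_len.
rewrite horizontal_act /layer; apply/idP/eqP => [i1|->]; last by lra.
by apply: base_between; lra.
Qed.

Lemma layer_high m : (m < n)%N ->
  (ups m)%:R * (k * a) + (downs m)%:R * (k * b)
  = b - (mu + nu) * (m.+1%:R * (k * eta)).
Proof.
move=> mn; have ke := ke_gt0.
have Ym : 0 < m.+1%:R * (k * eta) <= eta.
  by rewrite mulr_gt0 ?ltr0n //= mulrA ger_pMl // ler_pdivrMr // mul1r ler_nat.
rewrite -ids_len; last by case/andP: Ym => /ltW -> ->.
have dG : dnact (tile ids) (m.+1%:R * (k * eta)) by rewrite ids_dn.
rewrite -(tiling_dn (@proper_sides R T) (@bounded_sides R T) id til dG) -layer_sum.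
have E : m.+1%:R * (k * eta) = m%:R * (k * eta) + k * eta.
  by rewrite -natr1 mulrDl mul1r.
rewrite [RHS](eq_bigl (layer m)) => [|i].
  by apply: eq_bigr => i /eqP im; rewrite E -im horizontal_len.
rewrite horizontal_act /layer E; apply/idP/eqP => [i1|->]; last by lra.
by apply: base_between; lra.
Qed.

(** If all bases are parallel, the tiles form layers.  The length lost by
    crossing a layer forces it to contain one more upright tile than inverted
    ones, but then two consecutive layers cannot match along their common line. *)
Lemma positive_weights_absurd : False.
Proof.
have n1 : (1 < n)%N by [].
have nn0 : (0 < n)%N by apply: ltn_trans n1.
have := layer_low nn0; have := layer_high nn0.
have := layer_low n1; have := layer_high n1.
set U0 : R := (ups 0)%:R; set D0 : R := (downs 0)%:R.
set U1 : R := (ups 1)%:R; set D1 : R := (downs 1)%:R.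
have c0 : 0 < (mu + nu) * eta by rewrite mulr_gt0 ?slopes_gt0.
have a0 := roof_pos T; have bE := wid_roof T; set c := (mu + nu) * eta in c0 bE.
have cE m : (mu + nu) * (m%:R * (k * eta)) = m%:R * k * c by rewrite /c; ring.
rewrite !cE !mul0r subr0 !mul1r => hi1 lo1 hi0 lo0.
have kM x y : k * x = k * y -> x = y by apply: mulfI; exact: lt0r_neq0.
have t0 : U0 = D0 + 1.
  suff : U0 * c - D0 * c = c by move=> E; apply: (mulIf (lt0r_neq0 c0)); lra.
  by apply: kM; move: hi0 lo0; rewrite bE; lra.
have t1 : U1 = D1 + 1.
  suff : U1 * c - D1 * c = c by move=> E; apply: (mulIf (lt0r_neq0 c0)); lra.
  by apply: kM; move: hi1 lo1; rewrite bE; lra.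
have E : (D0 - D1) * (a + b) = c.
  apply: kM; move: hi0 lo1; rewrite t0 t1 bE; lra.
have ab : c < a + b by lra.
have [d01|d10] := leP D0 D1.
  have : (D0 - D1) * (a + b) <= 0 by rewrite mulr_le0_ge0 //; lra.
  by lra.
have d1 : D1 + 1 <= D0 by move: d10; rewrite ltr_nat /D1 natr1 ler_nat.
have : 1 * (a + b) <= (D0 - D1) * (a + b) by rewrite ler_pM2r; lra.
by lra.
Qed.

End Positive.
End Core.

(** * Weights of mixed sign *)

Section Mixed.
Variables (R : realType) (T : shape R) (I : finType) (n : nat).
Hypothesis n_ge2 : (2 <= n)%N.
Local Notation b := (wid T).
Local Notation eta := (hgt T).
Local Notation mu := (lsl T).
Local Notation nu := (rsl T).
Local Notation h := (shl T).
Local Notation a := (roof T).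
Local Notation tile g := (placed (sides T) g).
Local Notation k := (n%:R^-1 : R).
Local Notation tiles := (tiling (sides T)).
Local Notation ids := (ids R).

Variable g : I -> sim R.
Hypotheses (til : tiles ids g) (skg : forall i, sk (g i) = k).

Let n0 := nR_gt0 R n_ge2.
Let k0 := k_gt0 R n_ge2.
Let nk := nk1 R n_ge2.
Let kh := k_half R n_ge2.
Let e0 := hgt_gt0 T.
Let ke := ke_gt0 T n_ge2.
Let a0 := roof_pos T.

Lemma sum_gain (A : pred I) wa wb :
  \sum_(i | A i) gain wa wb (g i) = #|[pred i | A i && upright (g i)]|%:R * wb
    + #|[pred i | A i && inverted (g i)]|%:R * wa.
Proof.
rewrite (bigID (fun i => upright (g i))) /=; congr (_ + _).
  rewrite (eq_bigr (fun=> wb)) => [|i /andP[_ ui]]; last by rewrite gain_upright.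
  by rewrite sumr_const mulr_natl.
rewrite (bigID (fun i => inverted (g i))) /= [X in _ + X]big1 ?addr0; last first.
  by move=> i /andP[/andP[_ /negbTE ni] /negbTE nj]; rewrite /gain ni nj.
rewrite (eq_bigr (fun=> wa)) => [|i /andP[_ ui]]; last by rewrite gain_inverted.
rewrite sumr_const mulr_natl; congr (_ *+ _); apply: eq_card => i.
rewrite -!topredE /= -andbA; congr (_ && _).
by case: (boolP (inverted (g i))) => ii; rewrite ?andbF // inverted_not_upright.
Qed.

Lemma count_len_le (A B : pred I) (len : I -> R) l S :
    (forall i, A i -> 0 <= len i) -> (forall i, A i && B i -> len i = l) ->
  \sum_(i | A i) len i = S -> #|[pred i | A i && B i]|%:R * l <= S.
Proof.
move=> l0 Bl <-; rewrite (bigID B) /= (eq_bigr (fun=> l)) //.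
rewrite sumr_const mulr_natl lerDl sumr_ge0 // => i /andP[Ai _]; exact: l0.
Qed.

Lemma bottom_meets f Y : bottom (tile f) Y -> meets (tile f) Y.
Proof. by case/andP => /asboolP[]. Qed.

Lemma topmost_meets f Y : topmost (tile f) Y -> meets (tile f) Y.
Proof. by case/andP => /asboolP[]. Qed.

(** With a negative weight on the short base, the roof of the figure can only
    consist of [n] short bases.  The tiles below it widen [n] times as fast as
    the figure does. *)
Lemma negative_roof_absurd F wa wb : side_weights T k F wa wb ->
  wa < 0 -> 0 <= wb -> False.
Proof.
move=> Fw wa0 wb0.
have tG : topmost (tile ids) eta.
  by rewrite upright_topmost ?ids_upright //= mul1r add0r.
have := flow_roof n_ge2 Fw til (erefl _) skg tG.
rewrite (gain_upright _ _ (ids_upright R)) sum_gain.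
set NU := #|_|; set ND := #|_| => E.
have NUk : NU%:R * (k * a) <= a.
  apply: (count_len_le (len := fun i => hi (tile (g i)) eta - lo (tile (g i)) eta)).
  - by move=> i /topmost_meets; exact: tile_len_ge0.
  - move=> i /andP[ti ui]; move: ti; rewrite upright_topmost // skg => /eqP ->.
    rewrite upright_len // skg; last by have := ke; lra.
    by rewrite /roof; ring.
  - rewrite (roof_sum (@proper_sides R T) (@bounded_sides R T) id til tG).
    by rewrite ids_len // ltW //= lexx.
have NUn : NU%:R <= n%:R :> R.
  rewrite -(ler_pM2r (mulr_gt0 k0 a0)); apply: le_trans NUk _.
  by rewrite mulrA nk mul1r.
have nNU : n%:R <= NU%:R :> R.
  rewrite -(ler_nM2r wa0) -E lerDl mulr_ge0 //.
have {nNU}{}NUn : NU%:R = n%:R :> R by apply/eqP; rewrite eq_le NUn nNU.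
pose Y := eta - k * eta.
have kel := ke_le T n_ge2.
have YT : 0 <= Y < eta by rewrite /Y; have := ke; have := e0; lra.
have uG : upact (tile ids) Y by rewrite ids_up.
have : NU%:R * (k * b) <= b - (mu + nu) * Y.
  have -> : NU = #|[pred i | upact (tile (g i)) Y &&
      (topmost (tile (g i)) eta && upright (g i))]|.
    apply: eq_card => i; rewrite !inE.
    case: (boolP (_ && _)) => [/andP[ti ui]|]; last by rewrite andbF.
    move: ti; rewrite upright_topmost // upright_up // skg => /eqP Ee.
    by rewrite andbT; apply/esym; rewrite /Y {1 3}Ee; have := ke; lra.
  apply: (count_len_le (len := fun i => hi (tile (g i)) Y - lo (tile (g i)) Y)).
  - by move=> i /upact_meets; exact: tile_len_ge0.
  - move=> i /and3P[_ ti ui]; move: ti; rewrite upright_topmost // skg => /eqP Ee.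
    rewrite upright_len // ?skg; last by rewrite /Y; have := ke; lra.
    by rewrite /Y {1}Ee addrK subrr mulr0 subr0.
  - rewrite (tiling_up (@proper_sides R T) (@bounded_sides R T) id til uG).
    by rewrite ids_len //; case/andP: YT => -> /ltW.
rewrite NUn mulrA nk mul1r /Y; have c0 := slopes_gt0 T.
have : 0 < (mu + nu) * (eta - k * eta) by rewrite mulr_gt0 //; have := e0; lra.
by lra.
Qed.

Lemma leg_cs : (- (eta * mu)) ^+ 2 + eta ^+ 2 = 1.
Proof. by rewrite -[RHS](lleg_unit T); ring. Qed.

(** The rotation that lays the left leg of the figure on the axis of abscissas,
    with the figure above it. *)
Definition leg_rot := rot leg_cs.
Local Notation gl i := (comp leg_rot (g i)).

Let sgl i : sk (gl i) = k. Proof. by rewrite /= skg mul1r. Qed.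

Lemma leg_rot_left : on_left_leg T (comp leg_rot ids).
Proof.
rewrite /on_left_leg /=; apply/andP; split; apply/eqP; ring.
Qed.

Lemma left_leg_upright f : on_left_leg T (comp leg_rot f) -> se f = 1 ->
    sy (comp leg_rot f) = 0 ->
  upright f /\ sy f = - eta * sx (comp leg_rot f).
Proof.
move=> /andP[/eqP /= s1 /eqP /= c1] e1 /= y1; have u := lleg_unit T.
rewrite /upright e1 in c1 *.
have s1' : eta * (sc f - mu * ss f) = eta * 1 by lra.
have c1' : eta * (mu * sc f + ss f) = eta * mu by lra.
have y1' : eta * (sx f - mu * sy f) = eta * 0 by lra.
have en := lt0r_neq0 e0.
move/(mulfI en): s1' => s1'; move/(mulfI en): c1' => c1'; move/(mulfI en): y1' => y1'.
have xE : sx f = mu * sy f by lra.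
have scE : sc f = 1 + mu * ss f by lra.
have m2 : 0 < 1 + mu ^+ 2 by rewrite ltr_pwDl ?sqr_ge0.
have ssE : ss f = 0.
  apply: (mulfI (lt0r_neq0 m2)); rewrite mulr0.
  by move: c1'; rewrite scE; lra.
rewrite scE ssE mulr0 addr0 mulr1 !eqxx; split=> //.
by rewrite xE -[LHS]mulr1 -[X in _ * X = _]u; ring.
Qed.

Lemma shl_isosceles : nu = mu -> h = 1.
Proof.
move=> nm; have := rleg_shl T; rewrite nm lleg_unit => /eqP.
by rewrite sqrf_eq1 => /orP[/eqP //|/eqP h1]; have := shl_gt0 T; rewrite h1; lra.
Qed.

Lemma right_leg_upright f : on_right_leg T (comp leg_rot f) -> se f = -1 ->
    nu = mu -> sy (comp leg_rot f) = sk f * b * eta ->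
  upright f /\ sy f = - eta * (sx (comp leg_rot f) + mu * (sk f * b * eta)).
Proof.
move=> /andP[/eqP /= s1 /eqP /= c1] e1 nm /= y1; have u := lleg_unit T.
rewrite shl_isosceles // nm divr1 in s1 c1.
rewrite /upright e1 in c1 *.
have s1' : eta * (sc f - mu * ss f) = eta * -1 by lra.
have c1' : eta * (mu * sc f + ss f) = eta * - mu by lra.
have y1' : eta * (sx f - mu * sy f) = eta * (sk f * b) by lra.
have en := lt0r_neq0 e0.
move/(mulfI en): s1' => s1'; move/(mulfI en): c1' => c1'; move/(mulfI en): y1' => y1'.
have xE : sx f = mu * sy f + sk f * b by lra.
have scE : sc f = - 1 + mu * ss f by lra.
have m2 : 0 < 1 + mu ^+ 2 by rewrite ltr_pwDl ?sqr_ge0.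
have ssE : ss f = 0.
  apply: (mulfI (lt0r_neq0 m2)); rewrite mulr0.
  by move: c1'; rewrite scE; lra.
rewrite scE ssE mulr0 addr0 mulrNN mulr1 !eqxx; split=> //.
by rewrite xE -[LHS]mulr1 -[X in _ * X = _]u; ring.
Qed.

(** A tile resting on the long leg of the figure with one of its legs drifts at
    a rate of at least [- mu], the rate of the figure itself.  Equality forces
    its bases to be parallel to those of the figure. *)
Lemma leg_tile i : bottom (tile (gl i)) 0 ->
    lo (tile (gl i)) 0 < hi (tile (gl i)) 0 ->
    ~~ upright (gl i) -> ~~ inverted (gl i) ->
  exists L d len, [/\ leg_chords T (gl i) 0 L d len, 0 < len, - mu <= d &
    d = - mu -> [/\ len = k, upright (g i) & sy (g i) = - eta * (L + len)]].
Proof.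
move=> bi lth nu' ni; have mp := mu_gt0 T; have hp := shl_gt0 T.
have mn := rsl_le_lsl T; have mpn := slopes_gt0 T.
have seE : se (gl i) = se (g i) by rewrite /= mul1r.
case: (sides_bottom bi lth) => [ui|ii|[li]|[ri]].
- by rewrite ui in nu'.
- by rewrite ii in ni.
- move=> y0; have := left_leg_chords li; rewrite -y0 sgl seE => E.
  eexists; eexists; eexists; split; [exact: E|exact: k0| |].
    by case: (se_cases (g i)) => ->; lra.
  move=> dE; have e1 : se (g i) = 1 by case: (se_cases (g i)) dE => // ->; lra.
  have [ui ->] := left_leg_upright li e1 (esym y0).
  by rewrite e1 eqxx subrK.
move=> y0; have := right_leg_chords ri; rewrite -y0 sgl seE => E.
eexists; eexists; eexists; split; [exact: E|by rewrite mulr_gt0| |].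
  by case: (se_cases (g i)) => ->; lra.
move=> dE.
have [e1 nm] : se (g i) = -1 /\ nu = mu.
  by case: (se_cases (g i)) dE => ->; split=> //; lra.
have h1 := shl_isosceles nm.
have [|ui ->] := right_leg_upright ri e1 nm.
  by move: y0; rewrite sgl skg h1 divr1 => y0; lra.
split=> //; first by rewrite h1 mulr1.
rewrite e1 h1 nm skg divr1 mulr1.
have -> : (-1 == 1 :> R) = false by apply/negbTE/eqP; lra.
by congr (_ * _); ring.
Qed.

Lemma ids_leg_chords : leg_chords T (comp leg_rot ids) 0 (-1) (- mu) 1.
Proof.
have := left_leg_chords leg_rot_left.
have -> : sy (comp leg_rot ids) = 0 by rewrite /=; ring.
have -> : sx (comp leg_rot ids) = 0 by rewrite /=; ring.
have -> : se (comp leg_rot ids) = 1 by rewrite /=; ring.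
have -> : sk (comp leg_rot ids) = 1 by rewrite /=; ring.
by rewrite eqxx sub0r mul1r.
Qed.

Lemma leg_not_dn : ~~ dnact (tile (comp leg_rot ids)) 0.
Proof.
apply/asboolP => -[_ [[t Y] + /= Y0]].
rewrite closed_at => /and4P[_ _ + _]; rewrite /= => xy.
have : 0 <= eta * (1 + mu ^+ 2) * Y by lra.
rewrite pmulr_rge0; first by lra.
by rewrite mulr_gt0 // ltr_pwDl ?sqr_ge0.
Qed.

(** If no tile rests with its long base on the long leg of the figure, then a
    column of upright tiles lines this leg.  Indeed comparing the slices on the
    leg and slightly above it shows that the tiles that touch the leg along a
    segment do it along their own legs, and, by applying the telescoping
    identity to the square function, that they all drift at the same rate. *)
Lemma leg_column : (forall i, bottom (tile (gl i)) 0 -> ~~ upright (gl i)) ->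
  exists2 i, upright (g i) & sy (g i) = k * eta.
Proof.
move=> noup; have mp := mu_gt0 T; have mpn := slopes_gt0 T.
have til' := tiling_comp leg_rot til.
have skG : sk (comp leg_rot ids) = 1 by rewrite /= mulr1.
(* At heights up to [2 * z], the line still crosses both bases of the tiles that
   lie on one of their legs, and the legs of those that lie on a base. *)
pose z := Num.min (k * eta * a) (k * eta) / 2.
have kea : 0 < k * eta * a by rewrite mulr_gt0 ?ke.
have zz : [/\ 0 < z, z < k * eta & 2 * z <= k * eta * a].
  have m0 : 0 < Num.min (k * eta * a) (k * eta) by rewrite lt_min kea ke.
  have m1 : Num.min (k * eta * a) (k * eta) <= k * eta * a by rewrite ge_min lexx.
  have m2 : Num.min (k * eta * a) (k * eta) <= k * eta by rewrite ge_min lexx orbT.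
  by rewrite /z; split; lra.
clearbody z; case: zz => z0 zke zkea; have ea0 : 0 < eta * a by rewrite mulr_gt0.
have kea1 : k * eta * a <= 1 * eta * a.
  by rewrite -!mulrA ler_wpM2r // ?(ltW ea0) //; have := kh; lra.
have leg_up f L d len : leg_chords T f 0 L d len -> 0 < len ->
    2 * z <= sk f * eta * a -> upact (tile f) 0 /\ upact (tile f) z.
  move=> E l0 zf; split; apply/asboolP; split.
  - exists L; have /(_ L) := E 0 (leg_range0 T f).
    by rewrite mulr0 !addr0 lexx lerDl ltW.
  - exists (L + d * z, 0 + z); last by rewrite /=; lra.
    by rewrite E; [rewrite lexx lerDl ltW|lra].
  - by exists (L + d * z); rewrite -[z in (_, z)]add0r E; [rewrite lexx lerDl ltW|lra].
  - exists (L + d * (2 * z), 0 + 2 * z); last by rewrite /=; lra.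
    by rewrite E; [rewrite lexx lerDl ltW|lra].
have Ez (f : sim R) L d len : leg_chords T f 0 L d len -> 0 < len ->
    2 * z <= sk f * eta * a ->
    [/\ lo (tile f) 0 = L, hi (tile f) 0 = L + len, lo (tile f) z = L + d * z &
    hi (tile f) z = L + d * z + len].
  move=> E l0 zf; have zf1 : 0 <= z <= sk f * eta * a by lra.
  have [] := leg_lo_hi E (ltW l0) zf1; rewrite add0r => -> ->.
  by have [] := leg_lo_hi E (ltW l0) (leg_range0 T f); rewrite mulr0 !addr0 => -> ->.
have zG : 2 * z <= sk (comp leg_rot ids) * eta * a by rewrite skG; lra.
have [uG0 uGz] := leg_up _ _ _ _ ids_leg_chords ltr01 zG.
have [Glo Ghi Glz Ghz] := Ez _ _ _ _ ids_leg_chords ltr01 zG.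
have bG : bottom (tile (comp leg_rot ids)) 0.
  by rewrite /bottom uG0 leg_not_dn.
pose B i := bottom (tile (gl i)) 0 && (lo (tile (gl i)) 0 < hi (tile (gl i)) 0).
have Bleg i : B i -> inverted (gl i) \/
  exists L d len, [/\ leg_chords T (gl i) 0 L d len, 0 < len, - mu <= d &
    d = - mu -> [/\ len = k, upright (g i) & sy (g i) = - eta * (L + len)]].
  move=> /andP[bi lth]; have [|ni] := boolP (inverted (gl i)); first by left.
  by right; apply: leg_tile => //; exact: noup.
have zgl i : 2 * z <= sk (gl i) * eta * a by rewrite sgl.
pose len0 i := hi (tile (gl i)) 0 - lo (tile (gl i)) 0.
pose lenz i := hi (tile (gl i)) z - lo (tile (gl i)) z.
have inv_len i : inverted (gl i) -> B i ->
    upact (tile (gl i)) z /\ len0 i < lenz i.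
  move=> ii /andP[]; rewrite inverted_bottom // sgl => /eqP y0 _.
  split.
    have := ii; rewrite inverted_turn => ti.
    rewrite -[z]opprK -dnact_turn upright_dn //= -/(sk (gl i)) -/(sy (gl i)).
    rewrite mul1r skg; move: y0; rewrite /=; lra.
  rewrite /lenz /len0 !inverted_len ?sgl //; try by lra.
  have : 0 < (mu + nu) * z by rewrite mulr_gt0.
  by lra.
have Bup i : B i -> upact (tile (gl i)) z /\ len0 i <= lenz i.
  move=> Bi; case: (Bleg i Bi) => [/inv_len/(_ Bi)[-> /ltW //]|].
  move=> [L [d [len [E l0 _ _]]]]; have [_ ->] := leg_up _ _ _ _ E l0 (zgl i).
  by rewrite /lenz /len0; have [-> -> -> ->] := Ez _ _ _ _ E l0 (zgl i); split=> //; lra.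
have base_tel (F : R -> R) : \sum_(i | B i)
    (F (hi (tile (gl i)) 0) - F (lo (tile (gl i)) 0)) = F 0 - F (-1).
  have := base_sum (@proper_sides R T) (@bounded_sides R T) F til' bG.
  rewrite Glo Ghi (_ : -1 + 1 = 0); last by ring.
  move=> <-; rewrite [RHS](bigID (fun i => lo (tile (gl i)) 0 < hi (tile (gl i)) 0)) /=.
  rewrite [X in _ + X]big1 ?addr0 // => i /andP[bi]; rewrite -leNgt => hl.
  have [lh _] := chordP (reg_placed T (gl i)).2 (bottom_meets bi).
  by have /eqP -> : hi (tile (gl i)) 0 == lo (tile (gl i)) 0; rewrite ?eq_le ?hl ?lh ?subrr.
have up_tel (F : R -> R) : \sum_(i | upact (tile (gl i)) z)
    (F (hi (tile (gl i)) z) - F (lo (tile (gl i)) z)) =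
    F (- mu * z) - F (-1 - mu * z).
  rewrite (tiling_up (@proper_sides R T) (@bounded_sides R T) F til' uGz) Glz Ghz.
  by congr (F _ - F _); ring.
have split_up (w : I -> R) : \sum_(i | upact (tile (gl i)) z) w i =
    \sum_(i | B i) w i + \sum_(i | upact (tile (gl i)) z && ~~ B i) w i.
  rewrite (bigID B) /=; congr (_ + _); apply: eq_bigl => i.
  by case: (boolP (B i)) => [/Bup[->]|]; rewrite ?andbF.
have lenz_ge0 i : upact (tile (gl i)) z -> 0 <= lenz i.
  by move=> /upact_meets; exact: tile_len_ge0.
(* The slices at height [z] are at least as long as those on the leg, and both
   families have total length 1. *)
have excess : \sum_(i | B i) (lenz i - len0 i) = 0 /\
    \sum_(i | upact (tile (gl i)) z && ~~ B i) lenz i = 0.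
  have s1 : 0 <= \sum_(i | B i) (lenz i - len0 i).
    by rewrite sumr_ge0 // => i /Bup[_]; rewrite subr_ge0.
  have s2 : 0 <= \sum_(i | upact (tile (gl i)) z && ~~ B i) lenz i.
    by rewrite sumr_ge0 // => i /andP[/lenz_ge0].
  have := up_tel id; rewrite split_up.
  by move: s1; rewrite sumrB (base_tel id) -/lenz => s1; lra.
case: excess => exB exN.
have noinv i : B i -> ~~ inverted (gl i).
  move=> Bi; apply/negP => ii; have [_ lt] := inv_len i ii Bi.
  have nn j : B j -> 0 <= lenz j - len0 j by move=> /Bup[_]; rewrite subr_ge0.
  by have := psumr_eq0P nn exB Bi; lra.
have others (F : R -> R) : \sum_(i | upact (tile (gl i)) z && ~~ B i)
    (F (hi (tile (gl i)) z) - F (lo (tile (gl i)) z)) = 0.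
  have nn j : upact (tile (gl j)) z && ~~ B j -> 0 <= lenz j.
    by move=> /andP[/lenz_ge0].
  apply: big1 => i /(psumr_eq0P nn exN) /eqP; rewrite subr_eq0 => /eqP ->.
  by rewrite subrr.
pose d i := (lo (tile (gl i)) z - lo (tile (gl i)) 0) / z.
have zn := lt0r_neq0 z0.
have Bd i : B i -> [/\ lo (tile (gl i)) z = lo (tile (gl i)) 0 + d i * z,
    hi (tile (gl i)) z = hi (tile (gl i)) 0 + d i * z, 0 < len0 i, - mu <= d i &
    d i = - mu -> [/\ len0 i = k, upright (g i) &
      sy (g i) = - eta * hi (tile (gl i)) 0]].
  move=> Bi; case: (Bleg i Bi) => [ii|]; first by have := noinv i Bi; rewrite ii.
  move=> [L [d' [len [E l0 md dP]]]].
  have [e1 e2 e3 e4] := Ez _ _ _ _ E l0 (zgl i).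
  have dE : d i = d' by rewrite /d e1 e3; field.
  have lE : L + len - L = len by ring.
  by rewrite dE /len0 e1 e2 e3 e4 lE; split=> //; ring.
(* The square is not linear, so its telescoping sum also sees the drifts. *)
have drift : \sum_(i | B i) (d i + mu) * len0 i = 0.
  have sq := up_tel (fun x => x ^+ 2).
  rewrite split_up (others (fun x => x ^+ 2)) addr0 /= in sq.
  have /= sq0 := base_tel (fun x => x ^+ 2).
  have /= l1 := base_tel id.
  rewrite (eq_bigr (fun i => (hi (tile (gl i)) 0 ^+ 2 - lo (tile (gl i)) 0 ^+ 2)
    + 2 * z * ((d i + mu) * len0 i) - 2 * z * mu * len0 i)) in sq; last first.
    by move=> i /Bd[-> -> _ _ _]; rewrite /len0; ring.
  move: sq; rewrite sumrB big_split /= sq0 -!mulr_sumr /len0 l1 => sq.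
  have : 2 * z * (\sum_(i | B i) (d i + mu) * len0 i) = 0 by rewrite /len0; lra.
  by move/eqP; rewrite mulf_eq0 gt_eqF ?mulr_gt0 // => /eqP.
have dmu i : B i -> d i = - mu.
  move=> Bi; have nn j : B j -> 0 <= (d j + mu) * len0 j.
    by move=> /Bd[_ _ l0 md _]; rewrite mulr_ge0 ?(ltW l0) //; lra.
  have /eqP := psumr_eq0P nn drift Bi; have [_ _ l0 _ _] := Bd i Bi.
  by rewrite mulf_eq0 (gt_eqF l0) orbF => /eqP; lra.
have Bk i : B i -> hi (tile (gl i)) 0 = lo (tile (gl i)) 0 + k.
  by move=> Bi; have [_ _ _ _ /(_ (dmu i Bi))[<- _ _]] := Bd i Bi; rewrite /len0; ring.
have klt := k_lt1 R n_ge2.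
(* Inside the leg, the indicator of a point shows that some interval ends
   wherever another one begins.  One ends at 0, hence begins at [- k]. *)
pose delta (c x : R) : R := (x == c)%:R.
have tel c : \sum_(i | B i) (delta c (lo (tile (gl i)) 0 + k) -
    delta c (lo (tile (gl i)) 0)) = delta c 0 - delta c (-1).
  by rewrite -(base_tel (delta c)); apply: eq_bigr => i Bi; rewrite (Bk i Bi).
have hit c : 0 < \sum_(i | B i) delta c (lo (tile (gl i)) 0 + k) ->
    exists2 i, B i & lo (tile (gl i)) 0 + k = c.
  move=> pos; apply/not_exists2P => none; move: pos; rewrite big1 ?ltxx // => i Bi.
  by rewrite /delta; case: eqP => // E; have [] := none i.
have delta_ge0 c x : 0 <= delta c x by rewrite /delta ler0n.
have [i Bi iE] : exists2 i, B i & lo (tile (gl i)) 0 + k = 0.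
  apply: hit; have := tel 0.
  have -> : delta 0 0 = 1 by rewrite /delta eqxx.
  have -> : delta 0 (-1) = 0 by rewrite /delta oppr_eq0 oner_eq0.
  have : 0 <= \sum_(i | B i) delta 0 (lo (tile (gl i)) 0) by rewrite sumr_ge0.
  by rewrite sumrB => s0 s1; lra.
have [j Bj jE] : exists2 i, B i & lo (tile (gl i)) 0 + k = - k.
  apply: hit; have := tel (- k).
  have -> : delta (- k) 0 = 0.
    by rewrite /delta (_ : (0 == - k) = false) //; apply/negbTE/eqP; have := k0; lra.
  have -> : delta (- k) (-1) = 0.
    by rewrite /delta (_ : (-1 == - k) = false) //; apply/negbTE/eqP; lra.
  have : 1 <= \sum_(i | B i) delta (- k) (lo (tile (gl i)) 0).
    rewrite (bigD1 i) //= {1}/delta (_ : lo (tile (gl i)) 0 = - k); last by lra.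
    by rewrite eqxx lerDl sumr_ge0.
  by rewrite sumrB => s0 s1; lra.
have [_ _ _ _ /(_ (dmu j Bj))[_ uj yj]] := Bd j Bj.
by exists j => //; rewrite yj (Bk j Bj) jE; ring.
Qed.

(** With weights [0] and [wb > 0] the lower base of the figure consists of long
    bases only.  So no inverted tile lies in the lowest layer, hence no upright
    tile rests on top of that layer, against the column along the long leg. *)
Lemma zero_roof_absurd F wb : side_weights T k F 0 wb -> 0 < wb -> False.
Proof.
move=> Fw wb0.
have bG : bottom (tile ids) 0 by rewrite upright_bottom ?ids_upright.
have := flow_base n_ge2 Fw til (erefl _) skg bG.
rewrite (gain_upright _ _ (ids_upright R)) sum_gain mulr0 addr0.
set NU := #|_| => /(mulIf (lt0r_neq0 wb0)) NUn.
have noinv i : bottom (tile (g i)) 0 -> ~~ inverted (g i).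
  move=> bi; apply/negP => ii.
  have := base_sum (@proper_sides R T) (@bounded_sides R T) id til bG.
  rewrite ids_len ?lexx ?ltW // mulr0 subr0 (bigD1 i) //=.
  move: (bi); rewrite inverted_bottom // => /eqP y0.
  rewrite inverted_len //; last by move: y0; rewrite skg; have := ke; lra.
  have : #|[pred j | (bottom (tile (g j)) 0 && (j != i)) && upright (g j)]|%:R * (k * b)
      <= \sum_(j | bottom (tile (g j)) 0 && (j != i))
        (hi (tile (g j)) 0 - lo (tile (g j)) 0).
    apply: (count_len_le (len := fun j => hi (tile (g j)) 0 - lo (tile (g j)) 0)) => //.
      by move=> j /andP[/bottom_meets + _]; exact: tile_len_ge0.
    move=> j /andP[/andP[bj _] uj]; move: bj; rewrite upright_bottom // => /eqP ->.
    rewrite upright_len // ?skg ?subrr ?mulr0 ?subr0 //; have := ke; lra.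
  have -> : #|[pred j | (bottom (tile (g j)) 0 && (j != i)) && upright (g j)]| = NU.
    apply: eq_card => j; rewrite !inE.
    have [->|//] := eqVneq j i; last by rewrite andbT.
    by rewrite (inverted_not_upright ii) !andbF.
  rewrite NUn mulrA nk mul1r skg => s1 s2.
  have : 0 < k * a by rewrite mulr_gt0.
  move: s2; have -> : sy (g i) = k * eta by move: y0; rewrite skg; lra.
  by rewrite /roof; lra.
have [|i ui yi] := leg_column.
  move=> i bi; apply/negP => ui.
  have legb : bottom (tile (comp leg_rot ids)) 0.
    rewrite /bottom leg_not_dn andbT.
    by apply: (tile_upact (tiling_comp leg_rot til) (i := i)); case/andP: bi.
  have skG : sk (comp leg_rot ids) = 1 by rewrite /= mulr1.
  have := flow_base n_ge2 Fw (tiling_comp leg_rot til) skG sgl legb.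
  rewrite gain_slanted; last first.
    by rewrite /horizontal (eqP (andP leg_rot_left).1) gt_eqF.
  have nn j : bottom (tile (gl j)) 0 -> 0 <= gain 0 wb (gl j).
    by move=> _; rewrite /gain; case: ifP => _; [exact: ltW|case: ifP].
  by move/(psumr_eq0P nn)/(_ i bi); rewrite gain_upright //; lra.
have kel := ke_le T n_ge2.
have uG : upact (tile ids) (k * eta) by rewrite ids_up; have := ke; have := e0; lra.
have dG : dnact (tile ids) (k * eta) by rewrite ids_dn; have := ke; have := e0; lra.
have := flow Fw til skg uG dG; rewrite !sum_gain !mulr0 !addr0.
set U := #|_|; set D := #|_|.
have -> : D = 0%N.
  apply: eq_card0 => j; rewrite !inE; apply/negP => /andP[tj ij].
  have := noinv j; rewrite ij => /(_ _)/negP; apply => //.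
  move: tj; rewrite inverted_topmost // inverted_bottom // skg => /eqP <-.
  by rewrite subrr.
rewrite mul0r add0r => /eqP; rewrite mulf_eq0 (gt_eqF wb0) orbF pnatr_eq0.
rewrite /U => /eqP/card0_eq/(_ i); rewrite !inE ui upright_bottom // yi eqxx.
by [].
Qed.

End Mixed.

(** * From weights to rational spans *)

Section Rationality.
Variables (R : realType) (T : shape R) (I : finType) (n : nat).
Hypothesis n_ge2 : (2 <= n)%N.
Local Notation h := (shl T).
Local Notation a := (roof T).
Local Notation b := (wid T).
Local Notation k := (n%:R^-1 : R).

Variable g : I -> sim R.
Hypotheses (til : tiling (sides T) (ids R) g) (skg : forall i, sk (g i) = k).

Lemma weights_opp (F : R -> R) wa wb : side_weights T k F wa wb ->
  side_weights T k (fun t => - F t) (- wa) (- wb).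
Proof. by move=> [F1 Fh Fa Fb]; split=> t; rewrite ?F1 ?Fh ?Fa ?Fb ?opprD. Qed.

Lemma weights_zero (F : R -> R) wa wb :
  side_weights T k F wa wb -> wa = 0 /\ wb = 0.
Proof.
move=> Fw; have Fn := weights_opp Fw.
have [wa0|wa0|wa0] := ltgtP wa 0; last first.
- rewrite wa0 in Fw Fn; split=> //; rewrite oppr0 in Fn.
  have [wb0|wb0|//] := ltgtP wb 0.
    by case: (zero_roof_absurd n_ge2 til skg Fn); rewrite oppr_gt0.
  by case: (zero_roof_absurd n_ge2 til skg Fw).
- have [wb0|wb0] := leP wb 0.
    by case: (negative_roof_absurd n_ge2 til skg Fn); rewrite ?oppr_lt0 ?oppr_ge0.
  by case: (positive_weights_absurd n_ge2 til skg Fw).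
have [wb0|wb0] := leP 0 wb.
  by case: (negative_roof_absurd n_ge2 til skg Fw).
by case: (positive_weights_absurd n_ge2 til skg Fn); rewrite oppr_gt0.
Qed.

End Rationality.

Section Functionals.
Variable R : realType.

Definition rational_space (K : set R) := [/\ K 0,
  forall u v, K u -> K v -> K (u - v) & forall q u, K u -> K (ratr q * u)].

(** Representatives of the classes modulo [K + Q x] replace a Hamel basis:
    measuring a number against the representative of its class is enough to
    read off the coefficient along [x] of any increment. *)
Lemma rational_functional (K : set R) x : rational_space K -> ~ K x ->
  exists F : R -> R, forall t u (q : rat), K u ->
    F (t + u + ratr q * x) = F t + ratr q.
Proof.
move=> [K0 KB KZ] Kx.
pose cls t := [set t' | exists u (q : rat), K u /\ t' = t + u + ratr q * x].
have KN u : K u -> K (- u) by move=> Ku; rewrite -sub0r; exact: KB.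
have KD u v : K u -> K v -> K (u + v).
  by move=> Ku Kv; rewrite -[v]opprK; apply: KB => //; exact: KN.
have cls_eq t u (q : rat) : K u -> cls (t + u + ratr q * x) = cls t.
  move=> Ku; apply/seteqP; split => _ [v [r [Kv ->]]].
    by exists (u + v), (q + r); split; [exact: KD|rewrite rmorphD /=; ring].
  by exists (v - u), (r - q); split; [exact: KB|rewrite rmorphB /=; ring].
have rep t : exists q : rat, exists u,
    K u /\ xget 0 (cls t) = t + u + ratr q * x.
  have [|u [q uq]] := @xgetPex _ 0 (cls t); last by exists q, u.
  by exists t, 0, 0; split=> //; rewrite rmorph0 mul0r !addr0.
have [f fP] := choice rep.
exists (fun t => - ratr (f t)) => t u q Ku.
have [u1 [Ku1 E1]] := fP t; have [u2 [Ku2]] := fP (t + u + ratr q * x).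
rewrite cls_eq // E1 => E.
have E' : ratr (f t - q - f (t + u + ratr q * x)) * x = u + u2 - u1.
  by rewrite !rmorphB /=; lra.
have [r0|rn] := eqVneq (f t - q - f (t + u + ratr q * x)) 0.
  have -> : f t = q + f (t + u + ratr q * x) by lra.
  by rewrite rmorphD /=; ring.
case: Kx; have -> : x = ratr (f t - q - f (t + u + ratr q * x))^-1 * (u + u2 - u1).
  by rewrite -E' mulrA -rmorphM mulVf // rmorph1 mul1r.
by apply: KZ; apply: KB => //; exact: KD.
Qed.

Lemma Qadjoin_space (h : R) : rational_space (Qadjoin h).
Proof.
split=> [|_ _ [p [q ->]] [p' [q' ->]]|r _ [p [q ->]]].
- by exists 0, 0; rewrite rmorph0 mul0r addr0.
- by exists (p - p'), (q - q'); rewrite !rmorphB /=; ring.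
by exists (r * p), (r * q); rewrite !rmorphM /=; ring.
Qed.

Definition extend (K : set R) (a : R) : set R :=
  [set x | exists u (q : rat), K u /\ x = u + ratr q * a].

Lemma extend_space K a : rational_space K -> rational_space (extend K a).
Proof.
move=> [K0 KB KZ]; split.
- by exists 0, 0; rewrite rmorph0 mul0r addr0.
- move=> _ _ [u [q [Ku ->]]] [v [r [Kv ->]]]; exists (u - v), (q - r).
  by split; [exact: KB|rewrite rmorphB /=; ring].
move=> r _ [u [q [Ku ->]]]; exists (ratr r * u), (r * q).
by split; [exact: KZ|rewrite rmorphM /=; ring].
Qed.

End Functionals.

Section Bases.
Variables (R : realType) (T : shape R) (I : finType) (n : nat).
Hypothesis n_ge2 : (2 <= n)%N.
Local Notation h := (shl T).
Local Notation a := (roof T).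
Local Notation b := (wid T).
Local Notation k := (n%:R^-1 : R).

Variable g : I -> sim R.
Hypotheses (til : tiling (sides T) (ids R) g) (skg : forall i, sk (g i) = k).

(** The functional that reads off the coefficient along [x] vanishes on both
    legs and takes the values [p] and [q] on the bases. *)
Lemma no_functional K x (u v : R) (p q : rat) : rational_space K -> ~ K x ->
    K 1 -> K h -> K u -> K v ->
    a = u + ratr p * x -> b = v + ratr q * x ->
  p = 0 /\ q = 0.
Proof.
move=> KS Kx K1 Kh Ku Kv aE bE.
have [F FE] := rational_functional KS Kx; have n0 := nR_gt0 R n_ge2.
have nk c : n%:R * (k * c) = c by rewrite mulrA nk1 ?mul1r.
have F0 t w : K w -> F (t + w) = F t.
  by move=> Kw; have := FE t w 0 Kw; rewrite rmorph0 mul0r !addr0.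
suff : side_weights T k (fun t => F (n%:R * t)) (ratr p) (ratr q).
  by move=> /(weights_zero n_ge2 til skg)[/eqP + /eqP]; rewrite !fmorph_eq0 => /eqP -> /eqP ->.
split=> t; rewrite mulrDr ?nk.
- by rewrite nk1 // F0.
- by rewrite F0.
- by rewrite aE addrA FE.
by rewrite bE addrA FE.
Qed.

(** The long base lies in the rational span of the legs and of the short base,
    for otherwise a functional would vanish on all of these but not on the long
    base.  A functional that reads off the coefficient along the short base then
    shows that the short base already lies in the span of the legs. *)
Theorem bases_in_Qadjoin : Qadjoin h a /\ Qadjoin h b.
Proof.
have Q := Qadjoin_space h.
have Q1 : Qadjoin h 1 by exists 1, 0; rewrite rmorph1 rmorph0 mul0r addr0.
have Qh : Qadjoin h h by exists 0, 1; rewrite rmorph1 rmorph0 mul1r add0r.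
have inE w : Qadjoin h w -> extend (Qadjoin h) a w.
  by move=> Qw; exists w, 0; rewrite rmorph0 mul0r addr0.
have [v [q [Qv bE]]] : extend (Qadjoin h) a b.
  apply: contrapT => nb.
  have Ea : extend (Qadjoin h) a a.
    by exists 0, 1; rewrite rmorph1 mul1r add0r; split=> //; case: Q.
  have E0 : extend (Qadjoin h) a 0 by apply: inE; case: Q.
  have [||_ /eqP] := no_functional (p := 0) (q := 1) (extend_space a Q) nb
      (inE _ Q1) (inE _ Qh) Ea E0.
  - by rewrite rmorph0 mul0r addr0.
  - by rewrite rmorph1 mul1r add0r.
  by rewrite oner_eq0.
have Qa : Qadjoin h a.
  apply: contrapT => na.
  have Q0 : Qadjoin h 0 by case: Q.
  have [||/eqP] := no_functional (p := 1) (q := q) Q na Q1 Qh Q0 Qv.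
  - by rewrite rmorph1 mul1r add0r.
  - by [].
  by rewrite oner_eq0.
split=> //; rewrite bE; case: Q => Q0 QB QZ.
rewrite -[ratr q * a]opprK -(sub0r (ratr q * a)); apply: (QB) => //.
by apply: (QB) => //; exact: QZ.
Qed.

End Bases.

(** * The number of tiles *)

Section Packing.
Variable R : realType.
Local Notation leb2 := (@lebesgue_measure R \x @lebesgue_measure R)%E.

Definition box (c : R * R) (r : R) : set (R * R) :=
  `]c.1 - r, c.1 + r[%classic `*` `]c.2 - r, c.2 + r[%classic.

Lemma boxP c r p : box c r p <->
  (c.1 - r < p.1 < c.1 + r) /\ (c.2 - r < p.2 < c.2 + r).
Proof. by rewrite /box /= !in_itv. Qed.

Lemma measurable_box c r : measurable (box c r).
Proof. by apply: measurableX; exact: measurable_itv. Qed.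

Lemma length_itv (x r : R) : 0 <= r ->
  lebesgue_measure (`]x - r, x + r[%classic : set R) = (2 * r)%:E.
Proof.
move=> r0; rewrite lebesgue_measure_itv /= lte_fin.
case: ltP => [_|rn]; first by rewrite -EFinB; congr EFin; ring.
by congr EFin; lra.
Qed.

Lemma area_box c r : 0 <= r -> leb2 (box c r) = (4 * r ^+ 2)%:E.
Proof.
move=> r0; rewrite product_measure1E; try exact: measurable_itv.
transitivity ((2 * r)%:E * (2 * r)%:E)%E; first by congr (_ * _)%E; exact: length_itv.
by rewrite -EFinM; congr EFin; ring.
Qed.

Lemma fsum_const (I : finType) (x : R) :
  (\sum_(i \in [set: I]) x%:E)%E = (#|I|%:R * x)%:E.
Proof.
rewrite (fsbigE (index_enum I)) ?index_enum_uniq //; last first.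
  by move=> i _; rewrite mem_index_enum.
rewrite big_mkcond /= (eq_bigr (fun=> x%:E)) => [|i _]; last by rewrite in_setT.
by rewrite sumEFin sumr_const mulr_natl.
Qed.

Lemma boxes_inside (I : finType) (c : I -> R * R) r C S : 0 <= r -> 0 <= S ->
    (forall i j p, box (c i) r p -> box (c j) r p -> i = j) ->
    (forall i, box (c i) r `<=` box C S) ->
  #|I|%:R * r ^+ 2 <= S ^+ 2.
Proof.
move=> r0 S0 disj sub.
have : (leb2 (\bigcup_(i in [set: I]) box (c i) r) <= leb2 (box C S))%E.
  apply: le_measure; rewrite ?inE.
  - by apply: fin_bigcup_measurable => // i _; exact: measurable_box.
  - exact: measurable_box.
  - by move=> p [i _ ip]; exact: sub ip.
rewrite measure_fin_bigcup; [|exact: finite_finset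
  |by move=> i j _ _ [p [pi pj]]; exact: disj pi pj
  |by move=> i _; exact: measurable_box].
rewrite (eq_fsbigr (fun=> (4 * r ^+ 2)%:E)) => [|i _]; last exact: area_box.
by rewrite fsum_const area_box // lee_fin; lra.
Qed.

Lemma boxes_cover (I : finType) (c : I -> R * R) r C S : 0 <= r -> 0 <= S ->
    (forall p, box C S p -> exists i, box (c i) r p) ->
  S ^+ 2 <= #|I|%:R * r ^+ 2.
Proof.
move=> r0 S0 cov.
have : (leb2 (box C S) <= \sum_(i \in [set: I]) leb2 (box (c i) r))%E.
  apply: content_sub_fsum.
  - exact: finite_finset.
  - by move=> i _; exact: measurable_box.
  - exact: measurable_box.
  - by move=> p /cov[i ip]; exists i.
rewrite (eq_fsbigr (fun=> (4 * r ^+ 2)%:E)) => [|i _]; last exact: area_box.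
by rewrite fsum_const area_box // lee_fin; lra.
Qed.

(** Bernoulli's inequality. *)
Lemma bounded_powers (x c : R) : 0 < x -> (forall j, x ^+ j <= c) -> x <= 1.
Proof.
move=> x0 bd; rewrite leNgt; apply/negP => x1.
have bern (j : nat) : 1 + j%:R * (x - 1) <= x ^+ j.
  elim: j => [|j IH]; first by rewrite mul0r addr0.
  have : (1 + j%:R * (x - 1)) * x <= x ^+ j * x by rewrite ler_pM2r.
  have : 0 <= j%:R * (x - 1) * (x - 1) by rewrite !mulr_ge0 //; lra.
  by rewrite exprSr -natr1; lra.
have x10 : 0 < x - 1 by lra.
have := archi_boundP (x := c / (x - 1)); rewrite divr_ge0 ?(ltW x10) //; last first.
  by have := bd 0%N; rewrite expr0; lra.
move=> /(_ isT); rewrite ltr_pdivrMr // => lt.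
by have := bern (Num.Def.archi_bound (c / (x - 1))); have := bd (Num.Def.archi_bound (c / (x - 1))); lra.
Qed.

End Packing.

Section Iteration.
Variables (R : realType) (T : shape R).
Local Notation tile g := (placed (sides T) g).
Local Notation tiles := (tiling (sides T)).
Local Notation ids := (ids R).

Lemma un_ids p : un ids p = p.
Proof. by case: p => x y; rewrite /un /=; congr (_, _); field. Qed.

Lemma closed_ids p : closed_in (tile ids) p = closed_in (sides T) p.
Proof. by rewrite closed_placed un_ids. Qed.

(** A point of the smaller open polygon that lies on a side of the larger one
    could be pushed across this side. *)
Lemma open_sub (H K : seq (R * R * R)) p : proper H ->
    (forall p, closed_in K p -> closed_in H p) ->
  open_in K p -> open_in H p.
Proof.
move=> pH KH Kp; apply/allP => q qH.
have /allP/(_ q qH) := KH p (open_in_closed Kp); rewrite le0r => /predU1P[q0|//].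
pose pz z : R * R := (p.1 - z * q.1.1, p.2 - z * q.1.2).
have : \forall z \near (0 : R)^'+, forall r, r \in K ->
    0 < aff r p + (- (r.1.1 * q.1.1 + r.1.2 * q.1.2)) * z.
  by apply: near0_all => r rK; apply: near0_affine; exact: (allP Kp).
move=> /(filterI (nbhs_right_gt 0))/filter_ex[z [z0 zK]].
have /KH/allP/(_ q qH) : closed_in K (pz z).
  apply/allP => r rK; apply: ltW; have := zK r rK; rewrite /aff /pz /=.
  by congr (_ < _); ring.
have -> : aff q (pz z) = aff q p - z * (q.1.1 ^+ 2 + q.1.2 ^+ 2).
  by rewrite /aff /pz /=; ring.
rewrite q0 sub0r oppr_ge0 pmulr_rle0 //.
rewrite leNgt => /negP; case; have := pH q qH.
by case: eqP => [->|/eqP n1] /= n2; [rewrite expr0n add0r|rewrite ltr_pwDl ?sqr_ge0 //];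
  rewrite lt_def sqrf_eq0 sqr_ge0 ?n1 ?n2.
Qed.

Lemma tiling_iter (I J : finType) (g : I -> sim R) (f : J -> sim R) :
  tiles ids g -> tiles ids f -> tiles ids (fun ij : I * J => comp (g ij.1) (f ij.2)).
Proof.
move=> [gcov gdisj] [fcov fdisj]; split.
  move=> p; split.
    move=> /gcov[i]; rewrite closed_placed -closed_ids => /fcov[j fj].
    by exists (i, j); rewrite closed_in_comp.
  move=> [[i j]]; rewrite closed_in_comp => fj; apply/gcov; exists i.
  by rewrite closed_placed -closed_ids; apply/fcov; exists j.
have open_f j p : open_in (tile (f j)) p -> open_in (sides T) p.
  by apply: open_sub => [|q fq]; [exact: proper_sides|
    rewrite -closed_ids; apply/fcov; exists j].
move=> [i j] [i' j'] p; rewrite !open_in_comp => o o'.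
have ii : i = i'.
  by apply: (gdisj _ _ p); rewrite open_placed; apply: open_f; eassumption.
by rewrite -ii in o' *; congr (_, _); exact: fdisj o o'.
Qed.

Lemma tiling_ids : tiles ids (fun _ : unit => ids).
Proof. by split=> [p|[] [] //]; split=> [|[]] //; exists tt. Qed.

Lemma tiling_power (I : finType) (g : I -> sim R) k : tiles ids g ->
    (forall i, sk (g i) = k) -> forall j, exists (J : finType) (f : J -> sim R),
  [/\ tiles ids f, forall i, sk (f i) = k ^+ j & #|J| = (#|I| ^ j)%N].
Proof.
move=> til skg; elim=> [|j [J [f [tf skf cJ]]]].
  by exists unit, (fun=> ids); split; [exact: tiling_ids| |rewrite card_unit].
exists (I * J)%type, (fun ij => comp (g ij.1) (f ij.2)); split.
- exact: tiling_iter.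
- by move=> ij; rewrite /= skg skf exprS.
- by rewrite card_prod cJ expnS.
Qed.

(** A tile of scale [k] contains and is contained in squares whose sides are
    proportional to [k].  Comparing areas of squares in all iterates of a tiling
    shows that the powers of [N k^2] are bounded from above and below. *)
Lemma tile_count (I : finType) (g : I -> sim R) k : tiles ids g ->
  (forall i, sk (g i) = k) -> 0 < k -> #|I|%:R * k ^+ 2 = 1.
Proof.
move=> til skg k0.
have [K [K0 bK]] : exists K : R, 0 < K /\
    forall p, closed_in (sides T) p -> `|p.1| <= K /\ `|p.2| <= K.
  have [K bK] := @bounded_sides R T; exists (`|K| + 1); split.
    by rewrite ltr_wpDl.
  by move=> p /bK[b1 b2]; have := ler_norm K; split; lra.
(* A point of the midline at half a short base from the left leg is at a
   controlled distance from all sides. *)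
have [r [c [r0 bc]]] : exists (r : R) (c : R * R), 0 < r /\
    forall p, box c r p -> open_in (sides T) p.
  have e0 := hgt_gt0 T; have a0 := roof_pos T; have mn := slopes_gt0 T.
  pose m := `|lsl T| + `|rsl T|; pose c : R * R := (lsl T * (hgt T / 2) + (roof T) / 2, hgt T / 2).
  have m0 : 0 <= m by rewrite addr_ge0.
  pose r := Num.min (hgt T / 2) (roof T / (2 * (1 + m))).
  have r0 : 0 < r by rewrite lt_min !divr_gt0 // mulr_gt0 // ltr_pwDl.
  have r1 : r <= hgt T / 2 by rewrite ge_min lexx.
  have r2 : r * (1 + m) <= roof T / 2.
    have : r <= roof T / (2 * (1 + m)) by rewrite ge_min lexx orbT.
    by rewrite ler_pdivlMr ?mulr_gt0 ?ltr_pwDl //; lra.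
  exists r, c; split=> // p /boxP[/andP[x1 x2] /andP[y1 y2]].
  rewrite /c /= in x1 x2 y1 y2.
  have dy : `|p.2 - hgt T / 2| <= r by rewrite ler_norml; apply/andP; split; lra.
  have bd (s : R) : - (`|s| * r) <= s * (p.2 - hgt T / 2) <= `|s| * r.
    by rewrite -ler_norml normrM ler_wpM2l.
  have /andP[l1 l2] := bd (lsl T); have /andP[n1 n2] := bd (rsl T).
  have lr0 : 0 <= `|lsl T| * r by rewrite mulr_ge0 // ltW.
  have nr0 : 0 <= `|rsl T| * r by rewrite mulr_ge0 // ltW.
  have wE := wid_roof T.
  have mnh : 0 < (lsl T + rsl T) * hgt T by rewrite mulr_gt0.
  rewrite /open_in /= /aff /=; rewrite /m in r2.
  by apply/and5P; split=> //; lra.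
have bound (x y s t : R) : x ^+ 2 + y ^+ 2 = 1 -> `|s| <= t -> forall u, `|u| <= t ->
    `|x * s + y * u| <= 2 * t.
  move=> xy st u ut; have x1 : `|x| <= 1.
    rewrite -(@expr_le1 _ 2) // real_normK ?num_real //; have := sqr_ge0 y; lra.
  have y1 : `|y| <= 1.
    rewrite -(@expr_le1 _ 2) // real_normK ?num_real //; have := sqr_ge0 x; lra.
  apply: le_trans (ler_normD _ _) _; rewrite !normrM.
  have : `|x| * `|s| <= 1 * t by rewrite ler_pM.
  have : `|y| * `|u| <= 1 * t by rewrite ler_pM.
  by lra.
have e1 (f : sim R) : `|se f| = 1.
  by case: (se_cases f) => ->; rewrite ?normrN normr1.
have outer (f : sim R) p : closed_in (tile f) p -> box (sx f, sy f) (3 * K * sk f) p.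
  rewrite closed_placed -{2}(unK f p) => /bK[]; move: (un f p) => q q1 q2.
  have f0 := sk_gt0 f; have sKf : 0 < K * sk f by rewrite mulr_gt0.
  have b1 : `|sc f * q.1 + - ss f * (se f * q.2)| <= 2 * K.
    by apply: bound => //; [rewrite sqrrN sc_ss|rewrite normrM e1 mul1r].
  have b2 : `|ss f * q.1 + sc f * (se f * q.2)| <= 2 * K.
    by apply: bound => //; [rewrite addrC sc_ss|rewrite normrM e1 mul1r].
  have scale (x : R) : `|x| <= 2 * K -> - (2 * K * sk f) <= sk f * x <= 2 * K * sk f.
    by move=> xK; rewrite -ler_norml normrM (gtr0_norm f0) mulrC ler_pM2r.
  by apply/boxP; split; rewrite /app /=; [have := scale _ b1|have := scale _ b2]; lra.
have inner (f : sim R) p : box (app f c) (sk f * (r / 4)) p -> open_in (tile f) p.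
  rewrite open_placed => /boxP[p1 p2]; apply: bc; apply/boxP.
  have f0 := sk_gt0 f; rewrite -[c in c.1](appK f) -[c in c.2](appK f).
  move: (app f c) p1 p2 => q p1 p2.
  have d1 : `|p.1 - q.1| <= sk f * (r / 4) by rewrite ler_norml; lra.
  have d2 : `|p.2 - q.2| <= sk f * (r / 4) by rewrite ler_norml; lra.
  have d1' : `|se f * (p.1 - q.1)| <= sk f * (r / 4) by rewrite normrM e1 mul1r.
  have d2' : `|se f * (p.2 - q.2)| <= sk f * (r / 4) by rewrite normrM e1 mul1r.
  have b1 := bound _ _ _ _ (sc_ss f) d1 _ d2.
  have cs' : (- ss f) ^+ 2 + sc f ^+ 2 = 1 by rewrite sqrrN addrC sc_ss.
  have b2 := bound _ _ _ _ cs' d1' _ d2'.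
  have scale (x : R) : `|x| <= 2 * (sk f * (r / 4)) -> - r < x / sk f < r.
    rewrite ler_norml => /andP[x1 x2].
    rewrite ltr_pdivlMr // ltr_pdivrMr //.
    have : 0 < sk f * r by rewrite mulr_gt0.
    by move=> ?; apply/andP; split; lra.
  have E1 : (un f p).1 = (un f q).1 + (sc f * (p.1 - q.1) + ss f * (p.2 - q.2)) / sk f.
    by rewrite /un /=; field; exact: sk_neq0.
  have E2 : (un f p).2 = (un f q).2
      + (- ss f * (se f * (p.1 - q.1)) + sc f * (se f * (p.2 - q.2))) / sk f.
    by rewrite /un /=; field; exact: sk_neq0.
  by rewrite E1 E2; have := scale _ b1; have := scale _ b2; split; lra.
have N0 : 0 < #|I|%:R * k ^+ 2.
  rewrite mulr_gt0 ?exprn_gt0 // ltr0n; apply/card_gt0P.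
  have : closed_in (tile ids) c.
    rewrite closed_ids; apply: open_in_closed; apply: bc.
    by apply/boxP; split; lra.
  by move/til.1 => [i _]; exists i.
have powE j : (#|I|%:R * k ^+ 2) ^+ j = (#|I| ^ j)%:R * (k ^+ j) ^+ 2.
  by rewrite exprMn natrX -!exprM mulnC.
have upper : #|I|%:R * k ^+ 2 <= 1.
  apply: (@bounded_powers _ _ ((2 * K) ^+ 2 / (r / 4) ^+ 2)) => // j.
  have [J [f [tf skf cJ]]] := tiling_power til skg j.
  have kj : 0 < k ^+ j by rewrite exprn_gt0.
  rewrite ler_pdivlMr ?exprn_gt0 ?divr_gt0 // powE -cJ -mulrA -exprMn.
  apply: (@boxes_inside _ J (fun i => app (f i) c) _ (0, 0)).
  - by rewrite mulr_ge0 ?ltW ?divr_gt0.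
  - by rewrite mulr_ge0 ?ltW.
  - by move=> i i' p; rewrite -{1}(skf i) -(skf i') => /inner oi /inner; exact: tf.2.
  move=> i p; rewrite -(skf i) => /inner/open_in_closed pi.
  have : closed_in (tile ids) p by apply/tf.1; exists i.
  rewrite closed_ids => /bK[]; rewrite !ler_norml => b1 b2.
  by apply/boxP; rewrite /=; split; lra.
have lower : (#|I|%:R * k ^+ 2)^-1 <= 1.
  apply: (@bounded_powers _ _ ((3 * K) ^+ 2 / r ^+ 2)) => [|j].
    by rewrite invr_gt0.
  have [J [f [tf skf cJ]]] := tiling_power til skg j.
  have kj : 0 < k ^+ j by rewrite exprn_gt0.
  rewrite exprVn ler_pdivlMr ?exprn_gt0 // mulrC ler_pdivrMr ?exprn_gt0 //.
  rewrite powE -cJ mulrCA -exprMn.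
  apply: (@boxes_cover _ J (fun i => (sx (f i), sy (f i))) _ c).
  - by rewrite !mulr_ge0 ?ltW.
  - exact: ltW.
  move=> p /bc/open_in_closed; rewrite -closed_ids => /tf.1[i pi].
  by exists i; rewrite -(skf i); exact: outer.
by apply/eqP; rewrite eq_le upper /= -invf_le1.
Qed.

End Iteration.

(** * Similarities and congruences in terms of distances *)

Section Bridge.
Variable R : realType.
Implicit Types (x y A B C D : 'rV[R]_2) (G : sim R).

Definition co x : R * R := (x 0 0, x 0 1).
Definition pt (a b : R) : 'rV[R]_2 := \row_j (if j == 0 then a else b).

Lemma co_pt p : co (pt p.1 p.2) = p.
Proof. by rewrite /co !mxE /=; case: p. Qed.

Lemma co_inj x y : co x = co y -> x = y.
Proof.
move=> [x0 x1]; apply/rowP => -[[|[|//]] j].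
  by rewrite (_ : Ordinal j = 0) //; apply/val_inj.
by rewrite (_ : Ordinal j = 1) //; apply/val_inj.
Qed.

Definition dist2 (p q : R * R) : R := (p.1 - q.1) ^+ 2 + (p.2 - q.2) ^+ 2.

Lemma distE x y : dist x y = Num.sqrt (dist2 (co x) (co y)).
Proof. by rewrite /dist big_ord_recl big_ord1 /dist2 /=; congr (Num.sqrt (_ + (x 0 _ - y 0 _) ^+ 2)); apply/val_inj. Qed.

Lemma dist2_ge0 p q : 0 <= dist2 p q.
Proof. by rewrite addr_ge0 ?sqr_ge0. Qed.

Lemma dist_sq x y : dist x y ^+ 2 = dist2 (co x) (co y).
Proof. by rewrite distE sqr_sqrtr ?dist2_ge0. Qed.

Lemma dist_ge0 x y : 0 <= dist x y.
Proof. exact: sqrtr_ge0. Qed.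

Lemma dist_sym x y : dist x y = dist y x.
Proof. by rewrite !distE /dist2; congr Num.sqrt; ring. Qed.

(** Similarities in the sense of distances are affine: a point is determined by
    its distances to the images of the origin and of the two unit vectors. *)
Lemma similarity_sim k f : similarity k f ->
  exists2 s : sim R, sk s = k & forall x, co (f x) = app s (co x).
Proof.
move=> [k0 fd]; have kn := lt0r_neq0 k0.
pose q x := co (f x); pose o := pt 0 0.
have D x y : dist2 (q x) (q y) = k ^+ 2 * dist2 (co x) (co y).
  by rewrite -!dist_sq fd exprMn.
pose w x : R * R := (((q x).1 - (q o).1) / k, ((q x).2 - (q o).2) / k).
have Dw x y : dist2 (w x) (w y) = dist2 (co x) (co y).
  apply: (mulfI (expf_neq0 2 kn)); rewrite -D /dist2 /w /=; by field.
have wo : w o = (0, 0) by rewrite /w !subrr !mul0r.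
have coE (a b : R) : co (pt a b) = (a, b) := co_pt (a, b).
pose u := w (pt 1 0); pose v := w (pt 0 1).
have nrm x : (w x).1 ^+ 2 + (w x).2 ^+ 2 = (co x).1 ^+ 2 + (co x).2 ^+ 2.
  by have := Dw x o; rewrite wo /o coE /dist2 /= !subr0.
have uu : u.1 ^+ 2 + u.2 ^+ 2 = 1 by rewrite nrm coE /=; ring.
have vv : v.1 ^+ 2 + v.2 ^+ 2 = 1 by rewrite nrm coE /=; ring.
have [uE vE] : w (pt 1 0) = u /\ w (pt 0 1) = v by [].
clearbody u v.
have wu x : (w x).1 * u.1 + (w x).2 * u.2 = (co x).1.
  have := Dw x (pt 1 0); have := nrm x; rewrite uE coE /dist2.
  by move: (co x) (w x) => [y z] [r t] /= n d; lra.
have wv x : (w x).1 * v.1 + (w x).2 * v.2 = (co x).2.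
  have := Dw x (pt 0 1); have := nrm x; rewrite vE coE /dist2.
  by move: (co x) (w x) => [y z] [r t] /= n d; lra.
have uv : u.1 * v.1 + u.2 * v.2 = 0 by rewrite -uE wv coE.
pose e := u.1 * v.2 - u.2 * v.1.
have ee : e ^+ 2 = 1.
  transitivity ((u.1 ^+ 2 + u.2 ^+ 2) * (v.1 ^+ 2 + v.2 ^+ 2)
    - (u.1 * v.1 + u.2 * v.2) ^+ 2); first by rewrite /e; ring.
  by rewrite uu vv uv; ring.
have v1 : v.1 = - e * u.2.
  transitivity (v.1 * (u.1 ^+ 2 + u.2 ^+ 2)
    - u.1 * (u.1 * v.1 + u.2 * v.2)); first by rewrite uu uv; ring.
  by rewrite /e; ring.
have v2 : v.2 = e * u.1.
  transitivity (v.2 * (u.1 ^+ 2 + u.2 ^+ 2)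
    - u.2 * (u.1 * v.1 + u.2 * v.2)); first by rewrite uu uv; ring.
  by rewrite /e; ring.
exists (Sim (q o).1 (q o).2 k0 uu ee) => // x.
rewrite /app /= -[co (f x)]/(q x) [q x]surjective_pairing.
have qE1 : (q x).1 = (q o).1 + k * (w x).1 by rewrite /w /=; field.
have qE2 : (q x).2 = (q o).2 + k * (w x).2 by rewrite /w /=; field.
rewrite qE1 qE2 -[x 0 0]/((co x).1) -[x 0 1]/((co x).2) -(wu x) -(wv x) v1 v2.
congr (_ + k * _, _ + k * _).
  transitivity ((w x).1 * (u.1 ^+ 2 + e ^+ 2 * u.2 ^+ 2)
    + (w x).2 * u.1 * u.2 * (1 - e ^+ 2)); last by ring.
  by rewrite ee mul1r uu; ring.
transitivity ((w x).2 * (u.2 ^+ 2 + e ^+ 2 * u.1 ^+ 2)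
  + (w x).1 * u.1 * u.2 * (1 - e ^+ 2)); last by ring.
by rewrite ee mul1r addrC [_ ^+ 2 + _]addrC uu; ring.
Qed.

Definition diam_set (X : set 'rV[R]_2) :=
  [set d | exists x y, [/\ X x, X y & d = dist x y]].

(** Comparing diameters shows that congruent copies have the same ratio. *)
Lemma ratio_le (X P Q : set 'rV[R]_2) k k' f f' u K : 0 < K ->
    (forall x y, X x -> X y -> dist x y <= K) ->
    (exists x y, [/\ X x, X y & 0 < dist x y]) ->
    similarity k f -> f @` X = P -> similarity k' f' -> f' @` X = Q ->
    similarity 1 u -> u @` P = Q ->
  k <= k'.
Proof.
move=> K0 bd [x0 [y0 [Xx0 Xy0 d0]]] [k0 fk] fP [k'0 f'k] f'Q [_ u1] uQ.
pose S := sup (diam_set X).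
have sS : has_sup (diam_set X).
  split; first by exists (dist x0 y0), x0, y0.
  by exists K => _ [x [y [Xx Xy ->]]]; exact: bd.
have dS x y : X x -> X y -> dist x y <= S.
  by move=> Xx Xy; apply: (sup_upper_bound sS); exists x, y.
have S0 : 0 < S by apply: lt_le_trans d0 _; exact: dS.
have into x : X x -> exists2 z, X z & f' z = u (f x).
  move=> Xx; have : Q (u (f x)) by rewrite -uQ -fP; exists (f x) => //; exists x.
  by rewrite -f'Q => -[z Xz <-]; exists z.
have : S <= k' * S / k.
  apply: ge_sup; first by exists (dist x0 y0), x0, y0.
  move=> _ [x [y [Xx Xy ->]]]; rewrite ler_pdivlMr // mulrC -fk -[dist (f x) _]mul1r -u1.
  have [z Xz <-] := into x Xx; have [w Xw <-] := into y Xy.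
  by rewrite f'k ler_pM2l // dS.
by rewrite ler_pdivlMr // mulrC ler_pM2r.
Qed.

End Bridge.

(** * Trapezoids in normal form *)

Section NormalForm.
Variable R : realType.
Implicit Types (x X Y Z A B C D : 'rV[R]_2) (G : sim R).

Lemma inv_cs G : sc G ^+ 2 + (- (se G * ss G)) ^+ 2 = 1.
Proof. by rewrite sqrrN exprMn se_sq mul1r sc_ss. Qed.

Definition inv_sim G : sim R := Sim (un G (0, 0)).1 (un G (0, 0)).2
  (etrans (invr_gt0 (sk G)) (sk_gt0 G)) (inv_cs G) (se_sq G).

Lemma app_inv G p : app (inv_sim G) p = un G p.
Proof.
case: p => x y; rewrite /app /un /=; have kn := sk_neq0 G.
congr (_, _); last by field.
by case: (se_cases G) => ->; field.
Qed.

Lemma un_inv G p : un (inv_sim G) p = app G p.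
Proof. by rewrite -[p in LHS](appK G) -[un G _]app_inv appK. Qed.

Section Frame.
Variables (A : 'rV[R]_2) (c s e : R).
Hypotheses (cs : c ^+ 2 + s ^+ 2 = 1) (ee : e ^+ 2 = 1).

Definition frame : sim R := Sim (co A).1 (co A).2 ltr01 cs ee.
Definition lx X : R := (un frame (co X)).1.
Definition ly X : R := (un frame (co X)).2.

Lemma lxE X : lx X = c * (X 0 0 - A 0 0) + s * (X 0 1 - A 0 1).
Proof. by rewrite /lx /un /= divr1. Qed.

Lemma lyE X : ly X = e * (c * (X 0 1 - A 0 1) - s * (X 0 0 - A 0 0)).
Proof. by rewrite /ly /un /= divr1. Qed.

(** A reflected frame changes the sign of areas. *)
Lemma frame_cross X Y Z W : e * cross (Y - X) (W - Z) =
  (lx Y - lx X) * (ly W - ly Z) - (ly Y - ly X) * (lx W - lx Z).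
Proof.
rewrite !lxE !lyE /cross !mxE.
transitivity (e * (c ^+ 2 + s ^+ 2) * ((Y 0 0 - X 0 0) * (W 0 1 - Z 0 1)
  - (Y 0 1 - X 0 1) * (W 0 0 - Z 0 0))); first by rewrite cs mulr1.
by ring.
Qed.

Lemma frame_dist X Y : dist2 (co X) (co Y) = (lx X - lx Y) ^+ 2 + (ly X - ly Y) ^+ 2.
Proof.
rewrite !lxE !lyE /dist2 /=.
transitivity ((c ^+ 2 + e ^+ 2 * s ^+ 2) * (X 0 0 - Y 0 0) ^+ 2
  + (s ^+ 2 + e ^+ 2 * c ^+ 2) * (X 0 1 - Y 0 1) ^+ 2
  + 2 * c * s * (1 - e ^+ 2) * (X 0 0 - Y 0 0) * (X 0 1 - Y 0 1)); last by ring.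
by rewrite ee !mul1r cs addrC [s ^+ 2 + _]addrC cs; ring.
Qed.

Lemma frame_inj X Y : lx X = lx Y -> ly X = ly Y -> X = Y.
Proof.
move=> ex ey; apply: co_inj; apply: (can_inj (unK frame)).
by rewrite [LHS]surjective_pairing [RHS]surjective_pairing -/(lx X) ex -/(ly X) ey.
Qed.

Lemma frame_combo A' B C D s' t u v : s' + t + u + v = 1 ->
  lx (s' *: A' + t *: B + u *: C + v *: D)
    = s' * lx A' + t * lx B + u * lx C + v * lx D /\
  ly (s' *: A' + t *: B + u *: C + v *: D)
    = s' * ly A' + t * ly B + u * ly C + v * ly D.
Proof.
move=> stuv; have -> : s' = 1 - t - u - v by lra.
by rewrite !lxE !lyE !mxE; split; ring.
Qed.

End Frame.

Lemma convex_sign A B C D : convex_quadrilateral A B C D ->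
  exists2 e : R, e ^+ 2 = 1 & [/\ 0 < e * orient B C D & 0 < e * orient D A B].
Proof.
move=> [[q1 q2 q3 q4]|[q1 q2 q3 q4]]; first by exists 1; rewrite ?expr1n ?mul1r.
by exists (-1); rewrite ?sqrrN ?expr1n ?mulN1r ?oppr_gt0.
Qed.

Lemma dist_eq X Y r : 0 <= r -> dist2 (co X) (co Y) = r ^+ 2 -> dist X Y = r.
Proof. by move=> r0 E; rewrite distE E sqrtr_sqr ger0_norm. Qed.

(** The frame has its origin at the vertex where the long base meets the long
    leg.  Orientation puts the figure above the base, and the comparison of the
    legs gives the one of their slopes. *)
Lemma normal_form A B C D : convex_quadrilateral A B C D ->
    parallel (B - A) (D - C) -> dist C D < dist A B -> dist D A = 1 ->
    dist B C <= 1 ->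
  exists (T : shape R) G, [/\ sk G = 1, shl T = dist B C, roof T = dist C D,
    wid T = dist A B &
    forall x, region A B C D x <-> closed_in (placed (sides T) G) (co x)].
Proof.
move=> /convex_sign[e ee [oBCD oDAB]] par ab DA BC.
set b := dist A B in ab *.
have b0 : 0 < b by apply: le_lt_trans ab; exact: dist_ge0.
have bn := lt0r_neq0 b0.
have bE : b ^+ 2 = (B 0 0 - A 0 0) ^+ 2 + (B 0 1 - A 0 1) ^+ 2.
  by rewrite dist_sq /dist2 /=; ring.
pose c := (B 0 0 - A 0 0) / b; pose s := (B 0 1 - A 0 1) / b.
have cs : c ^+ 2 + s ^+ 2 = 1.
  by rewrite /c /s !expr_div_n -mulrDl -bE divff // expf_neq0.
have xA : lx A cs ee A = 0 by rewrite lxE; ring.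
have yA : ly A cs ee A = 0 by rewrite lyE; ring.
have xB : lx A cs ee B = b.
  rewrite lxE; transitivity (b ^+ 2 / b); last by field.
  by rewrite bE /c /s; field.
have yB : ly A cs ee B = 0 by rewrite lyE /c /s; field.
have parE := frame_cross A cs ee A B C D.
rewrite [cross _ _]par mulr0 xA yA xB yB !subr0 mul0r subr0 in parE.
pose eta := ly A cs ee D; pose xd := lx A cs ee D; pose xc := lx A cs ee C.
have yC : ly A cs ee C = eta.
  by move/esym/eqP: parE; rewrite mulf_eq0 (negbTE bn) /= subr_eq0 => /eqP.
have eta0 : 0 < eta.
  have := frame_cross A cs ee D A D B.
  rewrite -/(orient D A B) xA yA xB yB -/eta -/xd => E.
  have {}E : e * orient D A B = b * eta by rewrite E; ring.
  by move: oDAB; rewrite E pmulr_rgt0.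
have en := lt0r_neq0 eta0.
have xcd : xd < xc.
  have := frame_cross A cs ee B C B D.
  rewrite -/(orient B C D) xB yB yC -/eta -/xd -/xc => E.
  have {}E : e * orient B C D = eta * (xc - xd) by rewrite E; ring.
  by move: oBCD; rewrite E pmulr_rgt0 // subr_gt0.
have CDE : dist C D = xc - xd.
  apply: dist_eq; first by lra.
  by rewrite (frame_dist A cs ee) yC -/eta -/xc -/xd; ring.
have DAE : xd ^+ 2 + eta ^+ 2 = 1.
  rewrite -[RHS](expr1n R 2) -DA dist_sq (frame_dist A cs ee) xA yA.
  by rewrite !subr0.
have BCE : dist B C ^+ 2 = (b - xc) ^+ 2 + eta ^+ 2.
  by rewrite dist_sq (frame_dist A cs ee) xB yB yC -/xc sub0r sqrrN.
pose mu := xd / eta; pose nu := (b - xc) / eta.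
have muE : mu * eta = xd by rewrite /mu divfK.
have nuE : nu * eta = b - xc by rewrite /nu divfK.
have h0 : 0 < dist B C.
  rewrite lt_def dist_ge0 andbT; apply/eqP => h0; move: BCE.
  rewrite h0 expr0n /= => E; have := sqr_ge0 (b - xc).
  by have := exprn_gt0 2 eta0; lra.
have s0 : 0 < mu + nu.
  by rewrite -(@pmulr_lgt0 _ eta) // mulrDl muE nuE; rewrite CDE in ab; lra.
have nm : nu <= mu.
  have : dist B C ^+ 2 <= 1 by rewrite expr_le1 // dist_ge0.
  rewrite BCE -DAE => le; have {}le : (b - xc) ^+ 2 <= xd ^+ 2 by lra.
  rewrite -(@ler_pM2r _ eta) // muE nuE -subr_ge0.
  have sum0 : 0 < xd + (b - xc) by rewrite CDE in ab; lra.
  by rewrite -(@pmulr_lge0 _ (xd + (b - xc))) // -subr_sqr subr_ge0.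
have r0 : 0 < b - (mu + nu) * eta by rewrite mulrDl muE nuE; lra.
have ll : eta ^+ 2 * (1 + mu ^+ 2) = 1.
  by rewrite mulrDr mulr1 -exprMn (mulrC eta) muE addrC.
have rl : dist B C ^+ 2 = eta ^+ 2 * (1 + nu ^+ 2).
  by rewrite mulrDr mulr1 -exprMn (mulrC eta) nuE addrC.
exists (Shape eta0 h0 s0 nm r0 ll rl), (frame A cs ee); split=> //.
  by rewrite /roof /= mulrDl muE nuE CDE; ring.
move=> x; rewrite closed_placed closed_sides -/(lx A cs ee x) -/(ly A cs ee x).
rewrite /inT /=; split.
  move=> [s1 [t [u [v [[s10 t0 u0 v0] sum ->]]]]].
  have [-> ->] := frame_combo A cs ee A B C D sum.
  rewrite xA yA xB yB yC -/eta -/xc -/xd.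
  have k1 : 0 <= u * eta by rewrite mulr_ge0 // ltW.
  have k2 : 0 <= v * eta by rewrite mulr_ge0 // ltW.
  have k3 : 0 <= (s1 + t) * eta by rewrite mulr_ge0 ?addr_ge0 // ltW.
  have k4 : 0 <= t * b by rewrite mulr_ge0 // ltW.
  have k5 : 0 <= s1 * b by rewrite mulr_ge0 // ltW.
  have k6 : 0 <= u * (xc - xd) by rewrite mulr_ge0 //; lra.
  have k7 : 0 <= v * (xc - xd) by rewrite mulr_ge0 //; lra.
  have sE : s1 = 1 - t - u - v by lra.
  have E1 z : z * (s1 * 0 + t * 0 + u * eta + v * eta) = (u + v) * (z * eta) by ring.
  rewrite !E1 muE nuE sE in k3 k5 *.
  by apply/and4P; split; lra.
set X := lx _ _ _ x; set Y := ly _ _ _ x => /and4P[Y0 Y1 mX nX].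
pose tau := Y / eta; pose w := (1 - tau) * b + tau * (xc - xd).
have tE : tau * eta = Y by rewrite /tau divfK.
have t0 : 0 <= tau by rewrite divr_ge0 // ltW.
have t1 : tau <= 1 by rewrite ler_pdivrMr // mul1r.
have w0 : 0 < w.
  have : 0 <= (1 - tau) * (b - (xc - xd)).
    by rewrite mulr_ge0 ?subr_ge0 //; rewrite CDE in ab; lra.
  by rewrite /w; lra.
have mY : mu * Y = tau * xd by rewrite -tE -muE; ring.
have nY : nu * Y = tau * (b - xc) by rewrite -tE -nuE; ring.
pose rho := (X - tau * xd) / w.
have rE : rho * w = X - tau * xd by rewrite /rho divfK // lt0r_neq0.
have rho0 : 0 <= rho by rewrite divr_ge0 ?(ltW w0) // -mY subr_ge0.
have rho1 : rho <= 1 by rewrite ler_pdivrMr // mul1r /w; rewrite nY in nX; lra.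
(* Interpolate between the bases, then between the legs. *)
exists ((1 - tau) * (1 - rho)), ((1 - tau) * rho), (tau * rho), (tau * (1 - rho)).
have sum : (1 - tau) * (1 - rho) + (1 - tau) * rho + tau * rho + tau * (1 - rho) = 1.
  by ring.
split=> //; first by split; rewrite mulr_ge0 ?subr_ge0.
have [cx cy] := frame_combo A cs ee A B C D sum.
apply: (@frame_inj A _ _ _ cs ee).
  rewrite cx xA xB -/X -/xc -/xd.
  transitivity (tau * xd + rho * w); first by rewrite rE; ring.
  by rewrite /w; ring.
by rewrite cy yA yB yC -/Y -/eta -tE; ring.
Qed.

Lemma region_swap A B C D : region A B C D = region B A D C.
Proof.
have H A' B' C' D' : region A' B' C' D' `<=` region B' A' D' C'.
  move=> x [s [t [u [v [[s0 t0 u0 v0] E ->]]]]]; exists t, s, v, u.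
  split=> //; first by lra.
  by rewrite [t *: _ + _]addrC -!addrA; congr (_ + (_ + _)); rewrite addrC.
by apply/seteqP; split; exact: H.
Qed.

Lemma region_turn A B C D : region A B C D = region C D A B.
Proof.
have H A' B' C' D' : region A' B' C' D' `<=` region C' D' A' B'.
  move=> x [s [t [u [v [[s0 t0 u0 v0] E ->]]]]]; exists u, v, s, t.
  split=> //; first by lra.
  by rewrite -addrA addrC addrA.
by apply/seteqP; split; exact: H.
Qed.

Lemma orient_flip A B C : orient A B C = - orient C B A.
Proof. by rewrite /orient /cross !mxE; ring. Qed.

Lemma convex_swap A B C D : convex_quadrilateral A B C D ->
  convex_quadrilateral B A D C.
Proof.
by move=> [[q1 q2 q3 q4]|[q1 q2 q3 q4]]; [right|left]; split;
  rewrite orient_flip ?oppr_lt0 ?oppr_gt0.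
Qed.

Lemma convex_turn A B C D : convex_quadrilateral A B C D ->
  convex_quadrilateral C D A B.
Proof. by move=> [[*]|[*]]; [left|right]; split. Qed.

Lemma parallel_swap A B C D : parallel (B - A) (D - C) -> parallel (A - B) (C - D).
Proof. by rewrite /parallel /cross !mxE => E; rewrite -E; ring. Qed.

Lemma parallel_turn A B C D : parallel (B - A) (D - C) -> parallel (D - C) (B - A).
Proof. by rewrite /parallel /cross !mxE => E; lra. Qed.

(** Parallel vectors of the same length are equal or opposite.  In the first case
    the quadrilateral would cross itself, in the second case it would be a
    parallelogram. *)
Lemma bases_neq A B C D : trapezoid A B C D -> dist A B != dist C D.
Proof.
move=> [/convex_sign[e ee [oBCD oDAB]] par npar]; apply/eqP => E.
have E2 : dist2 (co A) (co B) = dist2 (co C) (co D) by rewrite -!dist_sq E.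
case: npar; move: par oBCD oDAB E2.
rewrite /parallel /orient /cross /dist2 !mxE /=.
pose u1 := B 0 0 - A 0 0; pose u2 := B 0 1 - A 0 1.
pose v1 := D 0 0 - C 0 0; pose v2 := D 0 1 - C 0 1.
pose w1 := C 0 0 - B 0 0; pose w2 := C 0 1 - B 0 1.
rewrite -/u1 -/u2 -/v1 -/v2 -/w1 -/w2 => par oBCD oDAB E2.
have {}E2 : u1 ^+ 2 + u2 ^+ 2 = v1 ^+ 2 + v2 ^+ 2.
  by move: E2; rewrite /u1 /u2 /v1 /v2; lra.
have -> : A 0 0 - D 0 0 = - (u1 + w1 + v1) by rewrite /u1 /w1 /v1; ring.
have -> : A 0 1 - D 0 1 = - (u2 + w2 + v2) by rewrite /u2 /w2 /v2; ring.
have {}oBCD : 0 < e * (w1 * v2 - w2 * v1).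
  have -> // : w1 * v2 - w2 * v1 =
    w1 * (D 0 1 - B 0 1) - w2 * (D 0 0 - B 0 0) by rewrite /w1 /w2 /v1 /v2; ring.
have {}oDAB : 0 < e * (u1 * (w2 + v2) - u2 * (w1 + v1)).
  have -> // : u1 * (w2 + v2) - u2 * (w1 + v1) =
    (A 0 0 - D 0 0) * (B 0 1 - D 0 1) - (A 0 1 - D 0 1) * (B 0 0 - D 0 0).
  by rewrite /u1 /u2 /w1 /w2 /v1 /v2; ring.
clearbody u1 u2 v1 v2 w1 w2.
have norm (x y : R) : x ^+ 2 + y ^+ 2 = 0 -> x = 0 /\ y = 0.
  move=> /eqP; rewrite paddr_eq0 ?sqr_ge0 // !sqrf_eq0 => /andP[/eqP -> /eqP ->].
  by [].
pose q := u1 * v1 + u2 * v2; pose N := u1 ^+ 2 + u2 ^+ 2.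
have /eqP : q ^+ 2 = N ^+ 2.
  transitivity ((u1 ^+ 2 + u2 ^+ 2) * (v1 ^+ 2 + v2 ^+ 2) - (u1 * v2 - u2 * v1) ^+ 2).
    by rewrite /q; ring.
  by rewrite par -E2 /N; ring.
rewrite eqf_sqr => /orP[] /eqP qN.
  have [x1 x2] : v1 - u1 = 0 /\ v2 - u2 = 0.
    by apply: norm; move: E2 qN; rewrite /q /N; lra.
  have e1 : v1 = u1 by lra.
  have e2 : v2 = u2 by lra.
  by move: oBCD oDAB; rewrite e1 e2; lra.
have [x1 x2] : v1 + u1 = 0 /\ v2 + u2 = 0.
  by apply: norm; move: E2 qN; rewrite /q /N; lra.
have -> : u1 + w1 + v1 = w1 by lra.
have -> : u2 + w2 + v2 = w2 by lra.
by ring.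
Qed.

(** Renaming the vertices puts the long base first and the long leg last. *)
Lemma trapezoid_form A B C D (h a b : R) : unit_trapezoid A B C D ->
    h = Num.min (dist B C) (dist D A) -> a = Num.min (dist A B) (dist C D) ->
    b = Num.max (dist A B) (dist C D) ->
  exists (T : shape R) G, [/\ sk G = 1, shl T = h, roof T = a, wid T = b &
    forall x, region A B C D x <-> closed_in (placed (sides T) G) (co x)].
Proof.
move=> [tr leg]; have ne := bases_neq tr; case: tr => conv par _.
wlog ab : A B C D leg ne conv par / dist C D < dist A B.
  move=> H hE aE bE; have [ab|ab|ab] := ltgtP (dist C D) (dist A B).
  - exact: H ab hE aE bE.
  - rewrite region_turn; apply: H => //.
    + by rewrite maxC.
    + by rewrite eq_sym.
    + exact: convex_turn.
    + exact: parallel_turn.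
    + by rewrite minC.
    + by rewrite minC.
    + by rewrite maxC.
  - by rewrite ab eqxx in ne.
wlog BCDA : A B C D leg ne conv par ab / dist B C <= dist D A.
  move=> H hE aE bE; have [le|le] := leP (dist B C) (dist D A).
    exact: H le hE aE bE.
  rewrite region_swap; apply: H.
  - by rewrite maxC (dist_sym A D) (dist_sym C B).
  - by rewrite (dist_sym B A) (dist_sym D C).
  - exact: convex_swap.
  - exact: parallel_swap.
  - by rewrite (dist_sym B A) (dist_sym D C).
  - by rewrite (dist_sym A D) (dist_sym C B) ltW.
  - by rewrite minC (dist_sym A D) (dist_sym C B).
  - by rewrite (dist_sym B A) (dist_sym D C).
  - by rewrite (dist_sym B A) (dist_sym D C).
rewrite (max_idPr BCDA) in leg; rewrite (min_idPl BCDA).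
rewrite (min_idPr (ltW ab)) (max_idPl (ltW ab)) => -> -> ->.
by apply: normal_form => //; rewrite -leg.
Qed.

End NormalForm.

(** * Dissections and tilings *)

Section Reptiles.
Variable R : realType.
Implicit Types (x : 'rV[R]_2).

Lemma co_affine_open (H : seq (R * R * R)) :
  open [set x | open_in H (co x)].
Proof.
elim: H => [|q H IH].
  by rewrite (_ : [set _ | _] = setT); [exact: openT|apply/seteqP].
rewrite (_ : [set _ | _] = [set x | 0 < aff q (co x)] `&` [set x | open_in H (co x)]).
  apply: openI => //.
  have : open ((fun x => aff q (co x)) @^-1` [set y : R | 0 < y]); last by [].
  apply: open_comp; last exact: open_gt.
  have cont : continuous (fun x : 'rV[R]_2 => q.1.1 * x 0 0 + q.1.2 * x 0 1 + q.2).
    move=> x; apply: (@cvgD _ _ _ (nbhs x)); last exact: cvg_cst.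
    apply: (@cvgD _ _ _ (nbhs x)); apply: (@cvgM _ _ (nbhs x)).
    - exact: cvg_cst.
    - exact: coord_continuous.
    - exact: cvg_cst.
    - exact: coord_continuous.
  by move=> x _; exact: cont.
by apply/seteqP; split=> x /= => [/andP[]|[? ?]]; [split|apply/andP; split].
Qed.

Section OneFigure.
Variables (T : shape R) (G : sim R) (X : set 'rV[R]_2).
Hypothesis GX : forall x, X x <-> closed_in (placed (sides T) G) (co x).
Local Notation tile g := (placed (sides T) g).

Lemma image_tile (f : 'rV[R]_2 -> 'rV[R]_2) (s : sim R) : (forall x, co (f x) = app s (co x)) ->
  forall x, (f @` X) x <-> closed_in (tile (comp s G)) (co x).
Proof.
move=> fs x; rewrite closed_in_comp; split.
  by move=> [y /GX Xy <-]; rewrite fs appK.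
move=> cx; exists (pt (un s (co x)).1 (un s (co x)).2).
  by apply/GX; rewrite co_pt.
by apply: co_inj; rewrite fs co_pt unK.
Qed.

(** Open tiles lie in the interiors of the pieces, hence they are disjoint. *)
Lemma dissection_tiling n (P : 'I_n -> set 'rV[R]_2) (f : 'I_n -> 'rV[R]_2 -> 'rV[R]_2)
    (s : 'I_n -> sim R) :
    dissection X P -> (forall i x, co (f i x) = app (s i) (co x)) ->
    (forall i, f i @` X = P i) ->
  tiling (sides T) (ids R) (fun i => comp (inv_sim G) (comp (s i) G)).
Proof.
move=> [cov disj] fs fP.
have PE i x : P i x <-> closed_in (tile (comp (s i) G)) (co x).
  by rewrite -fP; exact: image_tile.
have pre p : exists x, co x = app G p.
  by exists (pt (app G p).1 (app G p).2); rewrite co_pt.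
split=> [p|i j p]; have [x xE] := pre p.
  rewrite closed_ids -[p in X in X <-> _](appK G) -closed_placed -xE; split.
    move=> /GX; rewrite cov => -[i _ /PE ip]; exists i.
    by rewrite closed_in_comp un_inv -xE.
  move=> [i]; rewrite closed_in_comp un_inv -xE => /PE ip.
  by apply/GX; rewrite cov; exists i.
rewrite !open_in_comp un_inv -xE => oi oj.
apply/eqP/negPn/negP => /disj ij; suff : ((P i)° `&` (P j)°) x by rewrite ij.
have inter l : open_in (tile G) (un (s l) (co x)) -> (P l)° x.
  rewrite -open_in_comp.
  have sub : [set y | open_in (tile (comp (s l) G)) (co y)] `<=` (P l)°.
    rewrite -open_subsetE; last exact: co_affine_open.
    by move=> y /open_in_closed/PE.
  exact: sub.
exact: (conj (inter i oi) (inter j oj)).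
Qed.

Hypothesis skG : sk G = 1.

Lemma figure_bounded : exists2 K, 0 < K &
  forall x y, X x -> X y -> dist x y <= K.
Proof.
have [K bK] := @bounded_sides R T.
exists (4 * `|K| + 1); first by rewrite ltr_wpDl ?mulr_ge0.
move=> x y /GX + /GX; rewrite !closed_placed => /bK[x1 x2] /bK[y1 y2].
have E : dist2 (co x) (co y) = dist2 (un G (co x)) (un G (co y)).
  rewrite -[co x in LHS](unK G) -[co y in LHS](unK G).
  move: (un G (co x)) (un G (co y)) => [p q] [r t].
  rewrite /dist2 /app /= skG.
  transitivity ((sc G ^+ 2 + ss G ^+ 2) * (p - r) ^+ 2
    + se G ^+ 2 * (sc G ^+ 2 + ss G ^+ 2) * (q - t) ^+ 2); first by ring.
  by rewrite sc_ss se_sq !mul1r.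
have nK := ler_norm K.
have d (u v : R) : `|u| <= K -> `|v| <= K -> (u - v) ^+ 2 <= (2 * `|K|) ^+ 2.
  move=> uK vK; rewrite -real_normK ?num_real // ler_pXn2r ?nnegrE ?mulr_ge0 //.
  by apply: le_trans (ler_normB _ _) _; lra.
have : dist x y ^+ 2 <= (4 * `|K| + 1) ^+ 2.
  rewrite dist_sq E /dist2; have := d _ _ x1 y1; have := d _ _ x2 y2.
  have : 0 <= `|K| by []; move: (`|K|) => k k0.
  have := sqr_ge0 k; lra.
by rewrite ler_pXn2r ?nnegrE ?dist_ge0 // addr_ge0 ?mulr_ge0.
Qed.

Lemma figure_nontrivial : exists x y, [/\ X x, X y & 0 < dist x y].
Proof.
have b0 : 0 < wid T by have := wid_gt_roof T; have := roof_pos T; lra.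
have e0 := hgt_gt0 T.
pose p (t : R) := app G (t, 0).
have Xp t : 0 <= t <= wid T -> X (pt (p t).1 (p t).2).
  move=> tb; apply/GX; rewrite co_pt closed_placed closed_sides appK /inT /=.
  by rewrite !mulr0 addr0 lexx ltW //= tb.
exists (pt (p 0).1 (p 0).2), (pt (p (wid T)).1 (p (wid T)).2); split.
- by apply: Xp; rewrite lexx ltW.
- by apply: Xp; rewrite lexx ltW.
rewrite distE !co_pt sqrtr_gt0 /dist2 /p /app /= skG.
have -> : (sx G + 1 * (sc G * 0 - se G * ss G * 0)
  - (sx G + 1 * (sc G * wid T - se G * ss G * 0))) ^+ 2 +
  (sy G + 1 * (ss G * 0 + se G * sc G * 0)
  - (sy G + 1 * (ss G * wid T + se G * sc G * 0))) ^+ 2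
  = (sc G ^+ 2 + ss G ^+ 2) * wid T ^+ 2 by ring.
by rewrite sc_ss mul1r exprn_gt0.
Qed.

Lemma rep_tiling n : rep n X -> exists (g : 'I_n -> sim R) k,
  [/\ tiling (sides T) (ids R) g, 0 < k & forall i, sk (g i) = k].
Proof.
move=> [P [dis simP conP]].
have ex i : exists s : sim R, exists f : 'rV[R]_2 -> 'rV[R]_2,
    [/\ similarity (sk s) f, f @` X = P i & forall x, co (f x) = app s (co x)].
  have [k [f [fk fP]]] := simP i; have [s sk fs] := similarity_sim fk.
  by exists s, f; rewrite sk.
have [s sP] := choice ex; have [f fP] := choice sP.
have til := dissection_tiling dis (fun i => let: And3 _ _ E := fP i in E)
  (fun i => let: And3 _ E _ := fP i in E).
have [K K0 bd] := figure_bounded.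
have le i j : sk (s i) <= sk (s j).
  have [fi fXi _] := fP i; have [fj fXj _] := fP j; have [u [u1 uP]] := conP i j.
  exact: ratio_le K0 bd figure_nontrivial fi fXi fj fXj u1 uP.
have skE i : sk (comp (inv_sim G) (comp (s i) G)) = sk (s i).
  by rewrite /= skG invr1 mulr1 mul1r.
exists (fun i => comp (inv_sim G) (comp (s i) G)).
have [i0 _|none] := pickP (fun _ : 'I_n => true); last first.
  by exists 1; split=> // i; have := none i.
exists (sk (s i0)); split=> // [|i]; first exact: sk_gt0.
by rewrite skE; apply/eqP; rewrite eq_le !le.
Qed.

End OneFigure.
End Reptiles.

Unset Implicit Arguments.

Theorem theorem3p1 (R : realType) (A B C D : 'rV[R]_2) (h a b : R) :
  unit_trapezoid A B C D ->
  h = Num.min (dist B C) (dist D A) ->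
  a = Num.min (dist A B) (dist C D) ->
  b = Num.max (dist A B) (dist C D) ->
  reptile (region A B C D) ->
  Qadjoin h a /\ Qadjoin h b.
Proof.
move=> ut hE aE bE [n n2 repn].
have [T [G [skG <- <- <- GX]]] := trapezoid_form ut hE aE bE.
have [g [k [til k0 skg]]] := rep_tiling GX skG repn.
have := tile_count til skg k0; rewrite card_ord => nk.
have n0 : 0 < n%:R :> R by rewrite ltr0n; case: n n2 {repn g til skg nk}.
(* Composing the tiling with itself replaces the ratio, whose square is [1 / n],
   by the ratio [1 / n]. *)
apply: (bases_in_Qadjoin n2 (tiling_iter til til)) => ij /=.
rewrite !skg; apply: (mulfI (lt0r_neq0 n0)).
by rewrite divff ?lt0r_neq0 // -expr2.
Qed.
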